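(* Let $\kappa$ be a universal constant with the property (P) described in the context. Let $Y$ be an infinite-dimensional Banach space with the Lebesgue-Bochner discretization property, witnessed by a function $f:[1,\infty)\to[1,\infty)$, and put $g(t):=t f(t)$ for $t\in[1,\infty)$. Let $X$ be a Banach space with $1\le \dim X=n<\infty$, let $\varepsilon,\delta\in(0,1)$ satisfy $\delta\le \kappa\varepsilon^2/n^{5/2}$, and let $\mathcal{N}_\delta$ be a $\delta$-net in the unit ball $B_X$ of $X$. Then $$c_Y(X)\le g\left(\frac{1+\varepsilon}{1-\varepsilon}\,c_Y(\mathcal{N}_\delta)\right).$$ Consequently, if $g$ is increasing and $\delta^g_{X\hookrightarrow Y}(\varepsilon)$ denotes the supremum of those $\delta\in(0,1)$ for which the displayed inequality holds for all $\delta$-nets $\mathcal{N}_\delta$ of $B_X$, then $$\delta^g_{X\hookrightarrow Y}(\varepsilon)\ge \frac{\kappa\varepsilon^2}{n^{5/2}}.$$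
   Context: For metric spaces $(X,d_X)$ and $(Y,d_Y)$, $c_Y(X)$ denotes the infimum of the numbers $C$ for which there exist a map $f:X\to Y$ and a real number $r>0$ such that $r\,d_X(u,v)\le d_Y(f(u),f(v))\le rC\,d_X(u,v)$ for all $u,v\in X$. Banach spaces and their subsets carry the norm metric. A $\delta$-net in $B_X$ is a subset $\mathcal N_\delta\subseteq B_X$ such that every point of $B_X$ is at distance at most $\delta$ from some point of $\mathcal N_\delta$. For a probability measure $\mu$ and a Banach space $Z$, $L_p(\mu,Z)$ is the Lebesgue-Bochner space of $Z$-valued functions. For $K\ge 1$, a finite-dimensional normed space $W$ is called $K$-embeddable into a Banach space $Y$ if the infimum of the distortions $\|S\|\,\|S^{-1}|_{S(W)}\|$ over all injective linear maps $S:W\to Y$ is at most $K$ (the zero space is $K$-embeddable into every $Y$). A Banach space $Y$ has the Lebesgue-Bochner discretization property, witnessed by $f:[1,\infty)\to[1,\infty)$, if for any separable probability measure $\mu$, any $C\ge1$, and any finite-dimensional subspace $Z\subset Y$: whenever $W$ is a finite-dimensional subspace of $L_\infty(\mu,Z)$ such that $\|w\|_{L_\infty(\mu,Z)}\le C\|w\|_{L_1(\mu,Z)}$ for all $w\in W$, the space $W$ (with the $L_\infty(\mu,Z)$ norm) is $f(C)$-embeddable into $Y$. Property (P) of the constant $\kappa\in(0,1]$: whenever $\delta,\varepsilon\in(0,1)$ and $D\in[1,\infty)$ satisfy $\delta\le\kappa\varepsilon^2/(n^2D)$, $X,Y$ are Banach spaces with $\dim X=n<\infty$, $\mathcal N_\delta$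 is a $\delta$-net in $B_X$, and $c_Y(\mathcal N_\delta)\le D$, there exist a separable probability space $(\Omega,\nu)$, a finite-dimensional linear subspace $Z\subseteq Y$, and a linear operator $T:X\to L_\infty(\nu,Z)$ such that for all $x\in X$, $$\frac{1-\varepsilon}{D}\|x\|_X\le\|Tx\|_{L_1(\nu,Z)}\le\|Tx\|_{L_\infty(\nu,Z)}\le(1+\varepsilon)\|x\|_X.$$ The existence of such a universal constant $\kappa$ is a known theorem of Giladi, Naor and Schechtman. *)

(* Defs.v *)
From HB Require Import structures.
From mathcomp Require Import all_boot all_order all_algebra.
From mathcomp Require Import generic_quotient.
From mathcomp Require Import all_classical all_reals all_analysis ess_sup_inf.

Set Implicit Arguments.
Unset Strict Implicit.
Unset Printing Implicit Defensive.

Import Order.TTheory GRing.Theory Num.Theory.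
Import numFieldNormedType.Exports.

Local Open Scope classical_set_scope.
Local Open Scope ring_scope.

Section subspaces.
Context (R : realType) (V : lmodType R).

Definition lin_indep n (b : 'I_n -> V) :=
  forall a : 'I_n -> R, \sum_i a i *: b i = 0 -> forall i, a i = 0.

Definition span_of n (b : 'I_n -> V) : set V :=
  [set x | exists a : 'I_n -> R, x = \sum_i a i *: b i].

Definition has_dim (W : set V) (n : nat) :=
  exists2 b : 'I_n -> V, lin_indep b & W = span_of b.

Definition findim_subspace (W : set V) := exists n, has_dim W n.

End subspaces.

Section metric_distortion.
Context (R : realType) (X Y : normedModType R).

(* c_Y(A) for a subset A of X; it is +oo when A has no embedding of finite
   distortion into Y. *)
Definition distortion_into (A : set X) : \bar R :=
  ereal_inf [set C%:E | C in [set C : R | exists f : X -> Y, exists2 r : R,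
    0 < r & forall u v, A u -> A v ->
      r * `|u - v| <= `|f u - f v| <= r * C * `|u - v|]].

End metric_distortion.
Arguments distortion_into {R X} Y A.

Definition unit_ball (R : realType) (X : normedModType R) : set X :=
  [set x | `|x| <= 1].
Arguments unit_ball {R} X.

Definition is_net (R : realType) (X : normedModType R) (delta : R)
    (N : set X) :=
  N `<=` unit_ball X /\
  forall x, unit_ball X x -> exists2 y, N y & `|x - y| <= delta.

Section linear_distortion.
Context (R : realType).

Definition linear_on (V U : lmodType R) (W : set V) (S : V -> U) :=
  forall (a : R) u v, W u -> W v -> S (a *: u + v) = a *: S u + S v.

Definition opnorm_on (V U : normedModType R) (W : set V) (S : V -> U) : \bar R :=
  ereal_sup [set `|S w|%:E | w in W `&` unit_ball V].

Definition lin_distortion (V U : normedModType R) (W : set V) (S : V -> U) :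
    \bar R :=
  (opnorm_on W S * opnorm_on (S @` W) (pinv W S))%E.

(* W is a finite-dimensional linear subspace of V, with the norm of V. *)
Definition embeddable (V U : normedModType R) (W : set V) (K : R) : Prop :=
  (ereal_inf [set lin_distortion W S | S in
     [set S : V -> U | linear_on W S /\ {in W &, injective S}]] <= K%:E)%E.

End linear_distortion.
Arguments embeddable {R V} U W K.

(* The measure algebra of mu is separable; equivalently, L_1(mu) is. *)
Definition separable_measure d (T : measurableType d) (R : realType)
    (mu : {measure set T -> \bar R}) :=
  exists A : nat -> set T, (forall k, measurable (A k)) /\
    forall B, measurable B -> forall e : R, 0 < e ->
      exists k, (mu (B `+` A k) < e%:E)%E.

Section strong_measurability.
Context d (T : measurableType d) (R : realType) (E : normedModType R).

Definition simple_function (s : T -> E) :=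
  finite_set (range s) /\ forall y, measurable (s @^-1` [set y]).

Definition strongly_measurable (F : T -> E) :=
  exists2 s : nat -> T -> E, forall k, simple_function (s k) &
    forall t, s k t @[k --> \oo] --> F t.

Lemma simple_function_comp2 (h : E -> E -> E) (s1 s2 : T -> E) :
  simple_function s1 -> simple_function s2 ->
  simple_function (fun t => h (s1 t) (s2 t)).
Proof.
move=> [f1 m1] [f2 m2]; split.
  apply: (@sub_finite_set _ _ [set h x y | x in range s1 & y in range s2]).
    by move=> _ [t _ <-]; exists (s1 t) => //; exists (s2 t).
  exact: finite_image2.
move=> z.
have -> : (fun t => h (s1 t) (s2 t)) @^-1` [set z] =
  \bigcup_(x in range s1) \bigcup_(y in range s2 `&` [set y | h x y = z])
     (s1 @^-1` [set x] `&` s2 @^-1` [set y]).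
  apply/seteqP; split => [t /= <-|t [x _ [y [_ <-] [/= <- <-]]]//].
  by exists (s1 t) => //; exists (s2 t).
apply: fin_bigcup_measurable => // x _.
apply: fin_bigcup_measurable => [|y _]; first exact: finite_setIl.
exact: measurableI.
Qed.

Lemma strongly_measurable_lin (a : R) (F G : T -> E) :
  strongly_measurable F -> strongly_measurable G ->
  strongly_measurable (a *: F + G).
Proof.
move=> [s ss sF] [u uu uG]; exists (fun k t => a *: s k t + u k t) => [k|t].
  exact: (simple_function_comp2 (fun x y => a *: x + y)).
by apply: cvgD => //; apply: cvgZl_tmp.
Qed.

Lemma strongly_measurable0 : strongly_measurable (0 : T -> E).
Proof.
exists (fun=> 0) => [_|t]; last exact: cvg_cst.
split; first by apply: (@sub_finite_set _ _ [set 0]) => // _ [t _ <-].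
move=> y; have [->|y0] := eqVneq y 0.
  by rewrite (_ : _ @^-1` _ = setT)//; apply/seteqP; split.
rewrite (_ : _ @^-1` _ = set0)//; apply/seteqP; split => // t /= /esym /eqP.
by rewrite (negbTE y0).
Qed.

End strong_measurability.

(* The norm of L_p(mu, E), on functions. *)
Definition bochner_norm d (T : measurableType d) (R : realType)
    (E : normedModType R) (mu : {measure set T -> \bar R}) (p : \bar R)
    (F : T -> E) : \bar R :=
  Lnorm mu p (fun t => `|F t|%:E).

Section Linfty_functions.
Context d (T : measurableType d) (R : realType) (mu : probability T R)
  (E : normedModType R).

Lemma bochner_norm_ge0 p (F : T -> E) : (0 <= bochner_norm mu p F)%E.
Proof. exact: Lnorm_ge0. Qed.

Let mu_gt0 : (0 < mu [set: T])%E.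
Proof. by rewrite probability_setT. Qed.

Lemma bochner_normyE (F : T -> E) :
  bochner_norm mu +oo F = ess_sup mu (fun t => `|F t|%:E).
Proof.
rewrite /bochner_norm unlock mu_gt0; congr ess_sup.
by apply/funext => t /=; rewrite normr_id.
Qed.

Lemma bochner_normyD (F G : T -> E) :
  (bochner_norm mu +oo (F + G)%R
    <= bochner_norm mu +oo F + bochner_norm mu +oo G)%E.
Proof.
rewrite !bochner_normyE; apply: le_trans (ess_supD _ _ _).
by apply: le_ess_sup; apply: nearW => t /=; rewrite -EFinD lee_fin ler_normD.
Qed.

Lemma bochner_normyZ (a : R) (F : T -> E) :
  bochner_norm mu +oo (a *: F)%R = (`|a|%:E * bochner_norm mu +oo F)%E.
Proof.
rewrite !bochner_normyE -(@ess_supZl _ _ _ mu _ `|a|)//; congr ess_sup.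
by apply/funext => t /=; rewrite -EFinM normrZ.
Qed.

Lemma bochner_norm_ae (F G : T -> E) :
  (\forall t \ae mu, F t = G t) ->
  bochner_norm mu +oo F = bochner_norm mu +oo G.
Proof.
move=> FG; rewrite !bochner_normyE; apply: eq_ess_sup.
by apply: filterS FG => t ->.
Qed.

Definition Linfty_pred : {pred T -> E} :=
  [pred F | `[< strongly_measurable F /\ (bochner_norm mu +oo F < +oo)%E >]].

Lemma Linfty_submod : submod_closed Linfty_pred.
Proof.
split=> [|a F G].
  apply/asboolP; split; first exact: strongly_measurable0.
  by have := bochner_normyZ 0 0; rewrite scale0r normr0 mul0e => ->; rewrite ltry.
move=> /asboolP[mF bF] /asboolP[mG bG]; apply/asboolP; split.
  exact: strongly_measurable_lin.
apply: le_lt_trans (bochner_normyD _ _) _.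
by rewrite bochner_normyZ lte_add_pinfty// lte_mul_pinfty.
Qed.

HB.instance Definition _ :=
  GRing.isSubmodClosed.Build R (T -> E) Linfty_pred Linfty_submod.

(* Representatives: strongly measurable, essentially bounded functions. *)
Record Linfty_fun := MkLinftyFun {
  Linfty_val :> T -> E;
  Linfty_valP : Linfty_val \in Linfty_pred }.

HB.instance Definition _ := [isSub for Linfty_val].
HB.instance Definition _ := [Choice of Linfty_fun by <:].
HB.instance Definition _ := [SubChoice_isSubLmodule of Linfty_fun by <:].

Definition Linfty_eq (F G : Linfty_fun) := `[< \forall t \ae mu, F t = G t >].

Lemma Linfty_eq_refl : reflexive Linfty_eq.
Proof. by move=> F; apply/asboolP; exact: nearW. Qed.

Lemma Linfty_eq_sym : symmetric Linfty_eq.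
Proof.
by move=> F G; apply/idP/idP => /asboolP h; apply/asboolP; apply: filterS h.
Qed.

Lemma Linfty_eq_trans : transitive Linfty_eq.
Proof.
move=> G F H /asboolP FG /asboolP GH; apply/asboolP.
by apply: filterS2 FG GH => t -> ->.
Qed.

Canonical Linfty_equiv :=
  EquivRel Linfty_eq Linfty_eq_refl Linfty_eq_sym Linfty_eq_trans.

End Linfty_functions.

Local Open Scope quotient_scope.

(* The Lebesgue-Bochner space L_oo(mu, E), as almost everywhere classes. *)
Definition Linfty d (T : measurableType d) (R : realType)
    (mu : probability T R) (E : normedModType R) : Type :=
  {eq_quot @Linfty_eq d T R mu E}.

Section Linfty_space.
Context d (T : measurableType d) (R : realType) (mu : probability T R)
  (E : normedModType R).

Local Notation L := (Linfty mu E).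

HB.instance Definition _ := Choice.on L.
HB.instance Definition _ := EqQuotient.on L.

Implicit Types (F G : Linfty_fun mu E) (x y z : L) (a : R).

Lemma Linfty_ind (P : L -> Prop) : (forall F, P (\pi_L F)) -> forall x, P x.
Proof. by move=> PF x; rewrite -[x]reprK. Qed.

Lemma Linfty_piP F G : reflect (\forall t \ae mu, F t = G t)
  (\pi_L F == \pi_L G).
Proof. by rewrite eqmodE; exact: asboolP. Qed.

Lemma Linfty_reprK F : \forall t \ae mu, repr (\pi_L F) t = F t.
Proof. by apply/Linfty_piP; rewrite reprK. Qed.

Definition Linfty_zero : L := \pi_L 0.
Definition Linfty_opp x : L := \pi_L (- repr x).
Definition Linfty_add x y : L := \pi_L (repr x + repr y).
Definition Linfty_scale a x : L := \pi_L (a *: repr x).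

Lemma Linfty_addE F G : Linfty_add (\pi_L F) (\pi_L G) = \pi_L (F + G).
Proof.
apply/eqP/Linfty_piP.
by apply: filterS2 (Linfty_reprK F) (Linfty_reprK G) => t /= ? ?; congr (_ + _).
Qed.

Lemma Linfty_oppE F : Linfty_opp (\pi_L F) = \pi_L (- F).
Proof.
apply/eqP/Linfty_piP.
by apply: filterS (Linfty_reprK F) => t /= ?; congr (- _).
Qed.

Lemma Linfty_scaleE a F : Linfty_scale a (\pi_L F) = \pi_L (a *: F).
Proof.
apply/eqP/Linfty_piP.
by apply: filterS (Linfty_reprK F) => t /= ?; congr (_ *: _).
Qed.

Lemma Linfty_addA : associative Linfty_add.
Proof.
move=> x y z; elim/Linfty_ind: x => F; elim/Linfty_ind: y => G; elim/Linfty_ind: z => H.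
by rewrite !Linfty_addE addrA.
Qed.

Lemma Linfty_addC : commutative Linfty_add.
Proof.
move=> x y; elim/Linfty_ind: x => F; elim/Linfty_ind: y => G.
by rewrite !Linfty_addE addrC.
Qed.

Lemma Linfty_add0 : left_id Linfty_zero Linfty_add.
Proof. by move=> x; elim/Linfty_ind: x => F; rewrite Linfty_addE add0r. Qed.

Lemma Linfty_addN : left_inverse Linfty_zero Linfty_opp Linfty_add.
Proof. by move=> x; elim/Linfty_ind: x => F; rewrite Linfty_oppE Linfty_addE addNr. Qed.

HB.instance Definition _ := GRing.isZmodule.Build L
  Linfty_addA Linfty_addC Linfty_add0 Linfty_addN.

Lemma Linfty_piD F G : \pi_L (F + G) = \pi_L F + \pi_L G.
Proof. by rewrite -Linfty_addE. Qed.

Lemma Linfty_scaleA a b x :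
  Linfty_scale a (Linfty_scale b x) = Linfty_scale (a * b) x.
Proof. by elim/Linfty_ind: x => F; rewrite !Linfty_scaleE scalerA. Qed.

Lemma Linfty_scale1 : left_id 1 Linfty_scale.
Proof. by move=> x; elim/Linfty_ind: x => F; rewrite Linfty_scaleE scale1r. Qed.

Lemma Linfty_scaleDr : right_distributive Linfty_scale +%R.
Proof.
move=> a x y; elim/Linfty_ind: x => F; elim/Linfty_ind: y => G.
by rewrite -Linfty_piD !Linfty_scaleE scalerDr Linfty_piD.
Qed.

Lemma Linfty_scaleDl x : {morph Linfty_scale^~ x : a b / a + b}.
Proof.
by move=> a b; elim/Linfty_ind: x => F; rewrite !Linfty_scaleE scalerDl Linfty_piD.
Qed.

HB.instance Definition _ := GRing.Zmodule_isLmodule.Build R L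
  Linfty_scaleA Linfty_scale1 Linfty_scaleDr Linfty_scaleDl.

Lemma Linfty_piZ a F : \pi_L (a *: F) = a *: \pi_L F.
Proof. by rewrite -Linfty_scaleE. Qed.

Definition Linfty_norm x : R := fine (bochner_norm mu +oo (repr x)).

Lemma Linfty_normE F : (Linfty_norm (\pi_L F))%:E = bochner_norm mu +oo F.
Proof.
rewrite /Linfty_norm (bochner_norm_ae (Linfty_reprK F)) fineK//.
rewrite ge0_fin_numE ?bochner_norm_ge0//.
by have /asboolP[] := Linfty_valP F.
Qed.

Lemma Linfty_ler_normD x y :
  Linfty_norm (x + y) <= Linfty_norm x + Linfty_norm y.
Proof.
elim/Linfty_ind: x => F; elim/Linfty_ind: y => G.
by rewrite -Linfty_piD -lee_fin EFinD !Linfty_normE bochner_normyD.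
Qed.

Lemma Linfty_normrZ a x : Linfty_norm (a *: x) = `|a| * Linfty_norm x.
Proof.
elim/Linfty_ind: x => F; apply: EFin_inj.
by rewrite -Linfty_piZ EFinM !Linfty_normE bochner_normyZ.
Qed.

Lemma Linfty_norm0_eq0 x : Linfty_norm x = 0 -> x = 0.
Proof.
elim/Linfty_ind: x => F F0; move: (congr1 EFin F0).
rewrite Linfty_normE bochner_normyE => {}F0.
apply/eqP/Linfty_piP.
have := @ess_sup_ge _ _ _ mu (fun t => `|F t|%:E).
rewrite F0; apply: filterS => t.
by rewrite lee_fin normr_le0 => /eqP.
Qed.

HB.instance Definition _ := Lmodule_isNormed.Build R L
  Linfty_ler_normD Linfty_normrZ Linfty_norm0_eq0.

(* The L_p(mu, E) norm of an element of L_oo(mu, E). *)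
Definition Lp_norm (p : \bar R) x : \bar R := bochner_norm mu p (repr x).

Lemma Lp_normyE x : Lp_norm +oo x = `|x|%:E.
Proof.
have -> : `|x| = Linfty_norm x by [].
by rewrite -[X in Linfty_norm X]reprK Linfty_normE.
Qed.

(* For a closed linear subspace Z of E, this is L_oo(mu, Z) inside
   L_oo(mu, E). *)
Definition Linfty_in (Z : set E) : set L :=
  [set x | exists2 F : Linfty_fun mu E, forall t, Z (F t) & x = \pi_L F].

End Linfty_space.
Arguments Linfty_in {d T R} mu {E} Z.

(* f : [1, oo[ -> [1, oo[ is represented by a total function whose values
   outside of [1, oo[ are irrelevant. *)
Definition LB_discretization (R : realType) (Y : completeNormedModType R)
    (f : R -> R) : Prop :=
  (forall t, 1 <= t -> 1 <= f t) /\
  forall (d : measure_display) (Omega : measurableType d)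
    (mu : probability Omega R), separable_measure mu ->
  forall C : R, 1 <= C ->
  forall Z : set Y, findim_subspace Z ->
  forall W : set (Linfty mu Y), findim_subspace W -> W `<=` Linfty_in mu Z ->
  (forall w, W w -> (Lp_norm +oo w <= C%:E * Lp_norm 1 w)%E) ->
  embeddable Y W (f C).

(* The case n = 0 is vacuous: there the upper bound on delta is 0. *)
Definition GNS_constant (R : realType) (kappa : R) : Prop :=
  forall (delta eps D : R) (n : nat) (X Y : completeNormedModType R)
    (N : set X),
  0 < delta < 1 -> 0 < eps < 1 -> 1 <= D ->
  delta <= kappa * eps ^+ 2 / (n%:R ^+ 2 * D) ->
  has_dim [set: X] n -> is_net delta N -> (distortion_into Y N <= D%:E)%E ->
  exists (d : measure_display) (Omega : measurableType d)
    (nu : probability Omega R), separable_measure nu /\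
  exists2 Z : set Y, findim_subspace Z &
  exists2 T : {linear X -> Linfty nu Y}, forall x, Linfty_in nu Z (T x) &
  forall x : X,
    [/\ (((1 - eps) / D * `|x|)%:E <= Lp_norm 1 (T x))%E,
        (Lp_norm 1 (T x) <= Lp_norm +oo (T x))%E
      & (Lp_norm +oo (T x) <= ((1 + eps) * `|x|)%:E)%E].

(* c_Y(X) <= g ((1 + eps) / (1 - eps) * c_Y(N)). Since g takes real arguments,
   the finiteness of c_Y(N) is part of the assertion. *)
Definition discretization_bound (R : realType) (X Y : normedModType R)
    (g : R -> R) (eps : R) (N : set X) : Prop :=
  distortion_into Y N \is a fin_num /\
  (distortion_into Y [set: X]
    <= (g ((1 + eps) / (1 - eps) * fine (distortion_into Y N)))%:E)%E.
Arguments discretization_bound {R X} Y g eps N.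

Definition discretization_modulus (R : realType) (X Y : normedModType R)
    (g : R -> R) (eps : R) : R :=
  sup [set delta : R | 0 < delta < 1 /\
    forall N : set X, is_net delta N -> discretization_bound Y g eps N].

(* Main.v *)
Require Import Defs.
From HB Require Import structures.
From mathcomp Require Import all_boot all_order all_algebra.
From mathcomp Require Import all_classical all_reals all_analysis.
From mathcomp Require Import perm measurable_realfun ess_sup_inf ring lra.

(* Write D for c_Y(N). If D <= sqrt n, then property (P) applies and gives an
   operator from X into some L_oo(nu, Z), and the discretization property of Y
   embeds its image into Y. Dvoretzky's theorem would say that D <= sqrt n
   always holds; instead, the case D > sqrt n is treated by producing by hand
   an operator which the discretization property can be applied to. By John's
   theorem, X has a Euclidean norm |.| with ||x|| <= |x| <= sqrt n (1 + eta) ||x||.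
   By the Dvoretzky-Rogers lemma, Y contains a_1, ..., a_n of norm at least
   1 - eta with ||sum t_i a_i|| <= |t|. For independent signs e_i, the random
   vector sum e_i t_i a_i of Y has norm at most |t|, and averaging over all
   signs but one shows that its expected norm is at least
   (1 - eta) max |t_i| >= (1 - eta) |t| / sqrt n. Adding atoms of small mass at
   which t is sent to <t, om> a_1, with om in a net of the Euclidean ball, makes
   the L_oo norm comparable to |t|. Hence X embeds into L_oo with distortion about
   sqrt n, and on the image the L_oo norm is at most about sqrt n times the L_1
   norm. The factors (1 + eps) / (1 - eps) absorb all the losses. Both John's
   theorem and the Dvoretzky-Rogers lemma come from ellipsoids of almost
   maximal volume. *)

Set Implicit Arguments.
Unset Strict Implicit.
Unset Printing Implicit Defensive.

Import Order.TTheory GRing.Theory Num.Theory.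
Import numFieldNormedType.Exports.

Local Open Scope classical_set_scope.
Local Open Scope ring_scope.

(** * Euclidean coordinates *)

Section euclidean_norm.
Context {R : realType}.

Definition enorm n (t : 'rV[R]_n) : R := Num.sqrt (\sum_i t 0 i ^+ 2).

Lemma enorm_ge0 n (t : 'rV[R]_n) : 0 <= enorm t.
Proof. exact: sqrtr_ge0. Qed.

Lemma sqr_enorm n (t : 'rV[R]_n) : enorm t ^+ 2 = \sum_i t 0 i ^+ 2.
Proof. by rewrite sqr_sqrtr// sumr_ge0// => i _; exact: sqr_ge0. Qed.

Lemma sqr_enorm_mx n (t : 'rV[R]_n) : enorm t ^+ 2 = (t *m t^T) 0 0.
Proof. by rewrite sqr_enorm mxE; apply: eq_bigr => i _; rewrite mxE. Qed.

Lemma enormZ n (a : R) (t : 'rV[R]_n) : enorm (a *: t) = `|a| * enorm t.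
Proof.
rewrite -sqrtr_sqr -sqrtrM ?sqr_ge0// mulr_sumr; congr Num.sqrt.
by apply: eq_bigr => i _; rewrite mxE exprMn.
Qed.

Lemma enorm_coord n (t : 'rV[R]_n) i : `|t 0 i| <= enorm t.
Proof.
rewrite -sqrtr_sqr ler_wsqrtr// (bigD1 i)//= lerDl sumr_ge0// => j _.
exact: sqr_ge0.
Qed.

Lemma enorm_eq0 n (t : 'rV[R]_n) : enorm t = 0 -> t = 0.
Proof.
move=> t0; apply/rowP => i; apply/eqP; rewrite mxE -normr_le0 -t0.
exact: enorm_coord.
Qed.

Lemma enorm_gt0 n (t : 'rV[R]_n) : t != 0 -> 0 < enorm t.
Proof.
by move=> t0; rewrite lt_def enorm_ge0 andbT; apply: contra_neq t0; exact: enorm_eq0.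
Qed.

Lemma enorm_delta n (i : 'I_n) : enorm (delta_mx 0 i : 'rV[R]_n) = 1.
Proof.
rewrite /enorm (bigD1 i)//= big1 ?addr0 ?mxE ?eqxx ?expr1n ?sqrtr1// => j ji.
by rewrite mxE (negbTE ji) expr0n.
Qed.

Lemma enorm_le_sqrt n (t : 'rV[R]_n) (m : R) : 0 <= m ->
  (forall i, `|t 0 i| <= m) -> enorm t <= Num.sqrt n%:R * m.
Proof.
move=> m0 tm; rewrite -[m in leRHS]ger0_norm// -sqrtr_sqr -sqrtrM ?ler0n//.
rewrite ler_wsqrtr// mulr_natl -[X in _ <= _ *+ X]card_ord -sumr_const.
by apply: ler_sum => i _; rewrite -real_normK ?num_real// lerXn2r ?nnegrE.
Qed.

Lemma enorm_cauchy n (t u : 'rV[R]_n) :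
  `|\sum_i t 0 i * u 0 i| <= enorm t * enorm u.
Proof.
wlog : t / 0 <= \sum_i t 0 i * u 0 i => [wl|t0].
  have [|/ltW h] := leP 0 (\sum_i t 0 i * u 0 i); first exact: wl.
  have e : \sum_i (- t) 0 i * u 0 i = - \sum_i t 0 i * u 0 i.
    by rewrite -sumrN; apply: eq_bigr => i _; rewrite mxE mulNr.
  have := wl (- t); rewrite e normrN oppr_ge0 => /(_ h).
  by rewrite -[in X in _ <= X -> _]scaleN1r enormZ normrN1 mul1r.
rewrite ger0_norm//.
have [->|u0] := eqVneq u 0.
  rewrite big1 => [|i _]; last by rewrite mxE mulr0.
  by rewrite mulr_ge0// enorm_ge0.
have [->|{}t0'] := eqVneq t 0.
  rewrite big1 => [|i _]; last by rewrite mxE mul0r.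
  by rewrite mulr_ge0// enorm_ge0.
have pt := enorm_gt0 t0'; have pu := enorm_gt0 u0.
rewrite -(ler_pM2l (mulr_gt0 pt pu)).
have : 0 <= \sum_i (enorm u * t 0 i - enorm t * u 0 i) ^+ 2.
  by apply: sumr_ge0 => i _; exact: sqr_ge0.
have -> : \sum_i (enorm u * t 0 i - enorm t * u 0 i) ^+ 2 =
    enorm u ^+ 2 * \sum_i t 0 i ^+ 2
    - 2 * enorm u * enorm t * (\sum_i t 0 i * u 0 i)
    + enorm t ^+ 2 * \sum_i u 0 i ^+ 2.
  rewrite !mulr_sumr -sumrB -big_split/=; apply: eq_bigr => i _; ring.
rewrite -!sqr_enorm; nra.
Qed.

(** By Lagrange's identity, [(a p + b q)^2 + (a q - b p)^2 = (a^2 + b^2) (p^2 + q^2)]. *)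
Lemma cauchy2 (a b p q e : R) : 0 <= e -> a ^+ 2 + b ^+ 2 <= 1 ->
  p ^+ 2 + q ^+ 2 <= e ^+ 2 -> a * p + b * q <= e.
Proof.
move=> e0 ab pq; rewrite leNgt; apply/negP => lt_e.
have : e ^+ 2 < (a * p + b * q) ^+ 2 by rewrite ltrXn2r ?nnegrE// ltW// (le_lt_trans e0).
apply/negP; rewrite -leNgt; have := sqr_ge0 (a * q - b * p).
have := sqr_ge0 a; have := sqr_ge0 b; have := sqr_ge0 p; have := sqr_ge0 q.
by nra.
Qed.

End euclidean_norm.

(** * Linear combinations and comparison with the Euclidean norm *)

Section combinations.
Context {R : realType} {V : normedModType R}.

Definition comb n (b : 'I_n -> V) (t : 'rV[R]_n) : V := \sum_i t 0 i *: b i.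

Lemma comb_is_linear n (b : 'I_n -> V) : linear (comb b).
Proof.
move=> a t u; rewrite /comb scaler_sumr -big_split/=; apply: eq_bigr => i _.
by rewrite !mxE scalerDl scalerA.
Qed.

HB.instance Definition _ n (b : 'I_n -> V) :=
  GRing.isLinear.Build R 'rV[R]_n V *:%R (comb b) (comb_is_linear b).

Lemma comb_delta n (b : 'I_n -> V) i : comb b (delta_mx 0 i) = b i.
Proof.
rewrite /comb (bigD1 i)//= mxE !eqxx scale1r big1 ?addr0// => j ji.
by rewrite mxE (negbTE ji) scale0r.
Qed.

Lemma comb_mul n k (b : 'I_k -> V) (A : 'M[R]_(n, k)) (t : 'rV_n) :
  comb (fun i => comb b (row i A)) t = comb b (t *m A).
Proof.
rewrite /comb; under eq_bigr => i _ do rewrite scaler_sumr.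
rewrite exchange_big/=; apply: eq_bigr => j _; rewrite mxE scaler_suml.
by apply: eq_bigr => i _; rewrite scalerA mxE.
Qed.

Lemma continuous_comb n (b : 'I_n -> V) : continuous (comb b).
Proof.
apply: continuous_big => [|i _ t]; first exact: add_continuous.
have coordc := @coord_continuous R 1 n 0 i t.
exact: (cvgZr_tmp coordc).
Qed.

Lemma norm_comb_le n (b : 'I_n -> V) (t : 'rV[R]_n) :
  `|comb b t| <= (\sum_i `|b i|) * enorm t.
Proof.
rewrite mulr_suml; apply: le_trans (ler_norm_sum _ _ _) _.
apply: ler_sum => i _; rewrite normrZ mulrC ler_wpM2l//; exact: enorm_coord.
Qed.

(** On the compact Euclidean unit sphere the continuous function [|comb b t|] attains its minimum,
    which is positive by independence; homogeneity does the rest. In dimension 0 the sphere is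
    empty, hence the separate case. *)
Lemma comb_norm_equiv n (b : 'I_n -> V) : lin_indep b ->
  exists2 c : R, 0 < c & forall t, c * enorm t <= `|comb b t|.
Proof.
move=> bI; case: n b bI => [b _|n b bI].
  exists 1 => // t; rewrite /enorm big_ord0 sqrtr0 mulr0; exact: normr_ge0.
pose S : set 'rV[R]_n.+1 := [set t | enorm t = 1].
have S0 : S !=set0 by exists (delta_mx 0 0); exact: enorm_delta.
have cS : compact S.
  apply: bounded_closed_compact.
    exists 1; split=> // x x1 t St; apply: le_trans (ltW x1).
    rewrite (_ : `|t| = mx_norm t)// mx_normrE; apply/bigmax_leP; split=> // -[i j] _ /=.
    by rewrite (ord1 i) -St; exact: enorm_coord.
  rewrite (_ : S = (fun t => enorm t) @^-1` [set 1])//.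
  apply: closed_comp; last exact: closed_eq.
  move=> t _; apply: (@continuous_comp _ _ _ (fun t : 'rV[R]_n.+1 => \sum_i t 0 i ^+ 2)).
    apply: continuous_big => [|i _ u]; first exact: add_continuous.
    apply: (@continuous_comp _ _ _ (fun u : 'rV[R]_n.+1 => u 0 i) (fun x : R => x ^+ 2)).
      exact: coord_continuous.
    exact: exprn_continuous.
  exact: sqrt_continuous.
have cf : {within S, continuous (fun t : 'rV[R]_n.+1 => `|comb b t|)}.
  apply: continuous_subspaceT => t.
  exact: (cvg_norm (@continuous_comb _ b t)).
have [u Su minu] := EVT_min_rV S0 cS cf; rewrite inE in Su.
exists `|comb b u|.
  rewrite normr_gt0; apply: contra_eq_neq Su => /bI u0.
  have -> : u = 0 by apply/rowP => i; rewrite u0 mxE.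
  by rewrite -[X in enorm X](scale0r 0) enormZ normr0 mul0r eq_sym oner_eq0.
move=> t; have [->|/enorm_gt0 t0] := eqVneq t 0.
  by rewrite -[X in enorm X](scale0r 0) enormZ normr0 mul0r mulr0.
rewrite -ler_pdivlMr//.
have -> : `|comb b t| / enorm t = `|comb b ((enorm t)^-1 *: t)|.
  by rewrite linearZ normrZ gtr0_norm ?invr_gt0// mulrC.
apply: minu; rewrite inE/= /S/= enormZ gtr0_norm ?invr_gt0// mulVf// gt_eqF//.
Qed.

End combinations.

(** * Orthogonal matrices with prescribed rows *)

Section orthogonal_matrices.
Context {R : realType}.

Lemma enorm_orth n (O : 'M[R]_n) (t : 'rV_n) :
  O *m O^T = 1%:M -> enorm (t *m O) = enorm t.
Proof.
move=> OO; apply/eqP; rewrite -(@eqrXn2 _ 2) ?enorm_ge0//.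
by rewrite !sqr_enorm_mx trmx_mul mulmxA -(mulmxA t) OO mulmx1.
Qed.

Lemma det_orth n (O : 'M[R]_n) : O *m O^T = 1%:M -> `|\det O| = 1.
Proof.
move=> /(congr1 determinant); rewrite det_mulmx det_tr det1 -expr2 => h.
apply/eqP; rewrite -(@eqrXn2 _ 2)// real_normK ?num_real// h expr1n//.
Qed.

(* O is the Householder reflection exchanging the basis vector j with t. *)
Lemma orth_extension n (t : 'rV[R]_n) (j : 'I_n) : enorm t = 1 ->
  (forall i : 'I_n, (i < j)%N -> t 0 i = 0) ->
  exists2 O : 'M[R]_n, O *m O^T = 1%:M & row j O = t /\
    forall i : 'I_n, (i < j)%N -> row i O = delta_mx 0 i.
Proof.
move=> t1 tj; pose v : 'rV[R]_n := delta_mx 0 j - t.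
have [v0|v0] := eqVneq v 0.
  exists 1%:M; first by rewrite trmx1 mulmx1.
  split=> [|i _]; rewrite row1//.
  by apply/eqP; rewrite -subr_eq0; apply/eqP.
pose q := enorm v ^+ 2.
have q0 : q != 0 by rewrite expf_neq0// gt_eqF// enorm_gt0.
have vv : v *m v^T = q%:M by rewrite [LHS]mx11_scalar -sqr_enorm_mx.
pose O : 'M[R]_n := 1%:M - (2 / q) *: (v^T *m v).
have Orow i : row i O = delta_mx 0 i - (2 / q * v 0 i) *: v.
  rewrite rowE /O mulmxBr mulmx1 -scalemxAr mulmxA -rowE.
  have -> : row i v^T = (v 0 i)%:M by rewrite [LHS]mx11_scalar !mxE.
  by rewrite mul_scalar_mx scalerA.
have OT : O^T = O.
  by rewrite /O linearB/= linearZ/= trmx1 trmx_mul trmxK.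
exists O.
  have PP : ((2 / q) *: (v^T *m v)) *m ((2 / q) *: (v^T *m v)) =
      (2 / q) *: (v^T *m v) + (2 / q) *: (v^T *m v).
    rewrite -scalemxAl -scalemxAr mulmxA -(mulmxA v^T) vv mul_mx_scalar.
    rewrite -scalemxAl !scalerA -scalerDl; congr (_ *: _).
    by field.
  rewrite OT /O; move: (_ *: _) PP => P PP.
  by rewrite mulmxBl mul1mx mulmxBr mulmx1 PP opprB addrK subrK.
(* As [t] and the basis vector [j] are both unit vectors, [q] is twice the coordinate [v 0 j]. The
   coefficient of [v] in row [j] is therefore 1, which turns that row into [t]. *)
have qE : q = 2 * (1 - t 0 j).
  rewrite /q sqr_enorm (eq_bigr (fun i => (delta_mx 0 j : 'rV[R]_n) 0 i ^+ 2
    - 2 * ((delta_mx 0 j : 'rV[R]_n) 0 i * t 0 i) + t 0 i ^+ 2)) => [|i _].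
    rewrite big_split/= sumrB -!sqr_enorm enorm_delta t1 -mulr_sumr.
    rewrite (bigD1 j)//= big1 => [|i ij]; first by rewrite mxE !eqxx mulr1n; ring.
    by rewrite mxE (negbTE ij) mul0r.
  by rewrite !mxE; ring.
split=> [|i ij].
  rewrite Orow (_ : _ / _ * _ = 1).
    by rewrite scale1r opprB addrCA subrr addr0.
  rewrite /v !mxE !eqxx qE mulr1n; field.
  by move: q0; rewrite qE mulf_eq0 negb_or => /andP[].
rewrite Orow /v !mxE (tj _ ij) (_ : (i == j) = false) ?andbF ?subr0 ?mulr0.
  by rewrite scale0r subr0.
by apply/negbTE; apply: contraTneq ij => ->; rewrite ltnn.
Qed.

End orthogonal_matrices.

(** * Splitting into lower and upper coordinates *)

Section coordinate_splitting.
Context {R : realType} {n : nat}.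
Implicit Types (j : nat) (t : 'rV[R]_n).

Definition lowpart j t : 'rV[R]_n := \row_i (if (i < j)%N then t 0 i else 0).
Definition highpart j t : 'rV[R]_n := \row_i (if (i < j)%N then 0 else t 0 i).

Lemma enorm_split j t (x y : R) :
  enorm (x *: lowpart j t + y *: highpart j t) ^+ 2 =
  (x * enorm (lowpart j t)) ^+ 2 + (y * enorm (highpart j t)) ^+ 2.
Proof.
rewrite !exprMn !sqr_enorm !mulr_sumr -big_split/=; apply: eq_bigr => i _.
by rewrite !mxE; case: ifP => _; ring.
Qed.

Lemma split_lowhigh j t : t = lowpart j t + highpart j t.
Proof. by apply/rowP => i; rewrite !mxE; case: ifP; rewrite ?addr0 ?add0r. Qed.

Definition split_diag j (x y : R) : 'M[R]_n :=
  diag_mx (\row_i (if (i < j)%N then x else y)).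

Lemma mul_split_diag j t (x y : R) :
  t *m split_diag j x y = x *: lowpart j t + y *: highpart j t.
Proof.
apply/rowP => i; rewrite mul_mx_diag !mxE.
by case: ifP => _; rewrite mulr0 ?addr0 ?add0r mulrC.
Qed.

Lemma det_split_diag j (x y : R) : (j <= n)%N ->
  \det (split_diag j x y) = x ^+ j * y ^+ (n - j).
Proof.
move=> jn; rewrite det_diag.
under eq_bigr do rewrite mxE.
rewrite -(big_mkord xpredT (fun i => if (i < j)%N then x else y)).
rewrite (@big_cat_nat _ _ _ j)//=; congr (_ * _).
  rewrite (eq_big_nat _ _ (F2 := fun=> x)) ?prodr_const_nat ?subn0// => i.
  by case/andP => _ ->.
rewrite (eq_big_nat _ _ (F2 := fun=> y)) ?prodr_const_nat// => i.
by rewrite leqNgt => /andP[/negbTE ->].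
Qed.

End coordinate_splitting.

(** * Ellipsoids of almost maximal volume *)

Section extremal_position.
Context {R : realType} {V : normedModType R}.

Definition ellipsoid n (b : 'I_n -> V) (M : 'M[R]_n) :=
  forall t, `|comb b (t *m M)| <= enorm t.

(* Up to a factor 1 + tau, the ellipsoid [comb b] of the Euclidean ball has
   maximal volume in the unit ball of V. *)
Definition extremal (tau : R) n (b : 'I_n -> V) :=
  ellipsoid b 1%:M /\
  forall M : 'M[R]_n, ellipsoid b M -> `|\det M| <= 1 + tau.

Lemma ellipsoid_rows n (b : 'I_n -> V) (A M : 'M[R]_n) :
  ellipsoid (fun i => comb b (row i A)) M <-> ellipsoid b (M *m A).
Proof. by split=> h t; have := h t; rewrite comb_mul mulmxA. Qed.

(** The supremum of [|\det A|] over the ellipsoids inside the unit ball is positive and finite.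
    Choose [A] within a factor [1 + tau] of it: since determinants multiply, no ellipsoid written in
    the new basis gains more than that factor. *)
Lemma exists_extremal (tau : R) n (e : 'I_n -> V) : 0 < tau -> lin_indep e ->
  exists2 A : 'M[R]_n, A \in unitmx &
    extremal tau (fun i => comb e (row i A)).
Proof.
move=> tau0 eI; have [c c0 ce] := comb_norm_equiv eI.
pose D := [set `|\det A| | A in ellipsoid e].
pose K := 1 + \sum_i `|e i|.
have K0 : 0 < K by rewrite ltr_pwDl// sumr_ge0.
have DK : D (K^-1 ^+ n).
  exists (K^-1)%:M; last first.
    by rewrite det_scalar ger0_norm// exprn_ge0// invr_ge0 ltW.
  move=> t; rewrite mul_mx_scalar linearZ/= normrZ gtr0_norm ?invr_gt0//.
  rewrite mulrC ler_pdivrMr// mulrC; apply: le_trans (norm_comb_le _ _) _.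
  by rewrite ler_wpM2r ?enorm_ge0// lerDr.
have D0 : D !=set0 by exists (K^-1 ^+ n).
(* Row [i] of [A] gives a vector of norm at most 1, so its entries are at most [c^-1]; Leibniz's
   formula then bounds the determinant. *)
have Dub : has_ubound D.
  exists (\sum_(s : 'S_n) c^-1 ^+ n) => _ [A eA <-].
  apply: le_trans (ler_norm_sum _ _ _) _; apply: ler_sum => s _.
  rewrite normrM normrX normrN1 expr1n mul1r normr_prod.
  rewrite -[X in _ <= _ ^+ X]card_ord -prodr_const.
  apply: ler_prod => i _; rewrite normr_ge0/=.
  have : `|row i A 0 (s i)| <= c^-1.
    apply: le_trans (enorm_coord _ _) _; rewrite -[leRHS]mulr1 ler_pdivlMl//.
    by rewrite (le_trans (ce _))// rowE -(enorm_delta i); exact: eA.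
  by rewrite mxE.
have s0 : 0 < sup D.
  by apply: lt_le_trans (ub_le_sup Dub DK); rewrite exprn_gt0// invr_gt0.
have [|_ [A eA <-] ltA] := @sup_adherent _ D (sup D - sup D / (1 + tau)) _ (conj D0 Dub).
  by rewrite subr_gt0 ltr_pdivrMr ?ltr_pMr ?ltrDl// addr_gt0.
rewrite subKr in ltA.
have A0 : 0 < `|\det A|.
  by apply: lt_trans ltA; rewrite divr_gt0// addr_gt0.
exists A; first by rewrite unitmxE unitfE -normr_gt0.
split=> [|M]; rewrite ellipsoid_rows; first by rewrite mul1mx.
move=> eMA; rewrite -(ler_pM2r A0) -normrM -det_mulmx.
rewrite ltr_pdivrMr ?addr_gt0// mulrC in ltA.
by apply: le_trans (ltW ltA); apply: ub_le_sup => //; exists (M *m A).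
Qed.

Lemma extremal_orth (tau : R) n (b : 'I_n -> V) (O : 'M[R]_n) :
  O *m O^T = 1%:M -> extremal tau b ->
  extremal tau (fun i => comb b (row i O)).
Proof.
move=> OO [b1 bmax]; split=> [|M]; rewrite ellipsoid_rows.
  move=> t; have := b1 (t *m (1%:M *m O)); rewrite mulmx1 => /le_trans; apply.
  by rewrite mul1mx enorm_orth.
by move=> /bmax; rewrite det_mulmx normrM (det_orth OO) mulr1.
Qed.

(** Orthogonal changes of basis preserve extremality, so a chosen unit direction can be made the
    [j]-th basis vector without disturbing the vectors already placed before it. *)
Lemma extremal_rotate (tau : R) n (b : 'I_n -> V) (t : 'rV[R]_n) (j : 'I_n) :
  extremal tau b -> enorm t = 1 -> (forall i : 'I_n, (i < j)%N -> t 0 i = 0) ->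
  exists b' : 'I_n -> V, [/\ extremal tau b', b' j = comb b t &
    forall i : 'I_n, (i < j)%N -> b' i = b i].
Proof.
move=> bE t1 tj; have [Q QQ [Qj Qi]] := orth_extension t1 tj.
exists (fun i => comb b (row i Q)); split; first exact: extremal_orth.
  by rewrite Qj.
by move=> i ij; rewrite Qi// comb_delta.
Qed.

Lemma extremal_norm_le (tau : R) n (b : 'I_n -> V) t :
  extremal tau b -> `|comb b t| <= enorm t.
Proof. by case=> /(_ t); rewrite mulmx1. Qed.

(* With p and q the lower and upper parts of t, split a p + c q as
   (a - m) p + (m p + c q), using ||p|| <= |p| / d on the first term only; the
   choice of m makes the sum of both bounds a scalar product which the
   Cauchy-Schwarz inequality bounds by |t|. *)
Lemma stretched_ellipsoid n (b : 'I_n -> V) (s d : R) (j : nat) :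
  ellipsoid b 1%:M -> 1 < d -> 0 <= s <= 1 ->
  (forall t, `|comb b (lowpart j t)| <= enorm (lowpart j t) / d) ->
  ellipsoid b (split_diag j (Num.sqrt (1 + s * (d ^+ 2 - 1))) (Num.sqrt (1 - s))).
Proof.
move=> b1 d1 /andP[s0 s1] bd t.
have d2 : 1 < d ^+ 2 by nra.
set a := Num.sqrt (1 + _); set c := Num.sqrt (1 - s).
have aE : a ^+ 2 = 1 + s * (d ^+ 2 - 1).
  by rewrite sqr_sqrtr// addr_ge0// mulr_ge0// subr_ge0 ltW.
have cE : c ^+ 2 = 1 - s by rewrite sqr_sqrtr// subr_ge0.
have a0 : 0 < a by rewrite sqrtr_gt0 ltr_pwDl// mulr_ge0// subr_ge0 ltW.
have c0 : 0 <= c by exact: sqrtr_ge0.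
set p := enorm (lowpart j t); set q := enorm (highpart j t).
have p0 : 0 <= p by exact: enorm_ge0. have q0 : 0 <= q by exact: enorm_ge0.
have pq : p ^+ 2 + q ^+ 2 = enorm t ^+ 2.
  by have := enorm_split j t 1 1; rewrite !scale1r !mul1r -split_lowhigh.
have e0 := enorm_ge0 t.
have bound m : 0 <= m <= a -> `|comb b (t *m split_diag j a c)| <=
    (a - m) * (p / d) + enorm (m *: lowpart j t + c *: highpart j t).
  case/andP=> m0 ma; rewrite mul_split_diag.
  have -> : a *: lowpart j t + c *: highpart j t =
      (a - m) *: lowpart j t + (m *: lowpart j t + c *: highpart j t).
    by rewrite addrA -scalerDl subrK.
  rewrite linearD/= [comb b (_ *: _)]linearZ/=.
  apply: le_trans (ler_normD _ _) _; apply: lerD.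
    by rewrite normrZ ger0_norm ?subr_ge0// ler_wpM2l ?subr_ge0//; exact: bd.
  by have := b1 (m *: lowpart j t + c *: highpart j t); rewrite mulmx1.
pose r := Num.sqrt (d ^+ 2 - 1).
have r0 : 0 < r by rewrite sqrtr_gt0 subr_gt0.
have rE : r ^+ 2 = d ^+ 2 - 1 by rewrite sqr_sqrtr// subr_ge0 ltW.
have d0 : 0 < d by lra.
(* For [r p <= q] take [m = a]: the bound becomes [a^2 p^2 + c^2 q^2 = p^2 + q^2 + s (r^2 p^2 -
   q^2)], which is at most [|t|^2]. *)
have [pqle|ltpq] := leP (r * p) q.
  apply: le_trans (bound a _) _; first by rewrite lexx ltW.
  rewrite subrr mul0r add0r -(@ler_pXn2r _ 2) ?nnegrE ?enorm_ge0// enorm_split.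
  rewrite -/p -/q !exprMn -pq aE cE -rE.
  have : (r * p) ^+ 2 <= q ^+ 2 by rewrite lerXn2r ?nnegrE// mulr_ge0// ltW.
  rewrite exprMn; nra.
have p_gt0 : 0 < p.
  by rewrite lt_def p0 andbT; apply: contraTneq ltpq => ->; rewrite mulr0 -leNgt.
(* This [m] minimizes the bound. It gives [(m p)^2 + (c q)^2 = (m p)^2 (1 + r^2) = (m p d)^2], which
   removes the square root. *)
pose m := c * q / (r * p).
have mE : m * (r * p) = c * q by rewrite divfK// gt_eqF// mulr_gt0.
have m0 : 0 <= m by rewrite divr_ge0 ?mulr_ge0// ltW.
have mpd0 : 0 <= m * p * d by apply: mulr_ge0; [exact: mulr_ge0|exact: ltW].
have c1 : c <= 1 by rewrite -sqrtr1 ler_wsqrtr// gerBl.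
have a1 : 1 <= a by rewrite -{1}sqrtr1 ler_wsqrtr// lerDl mulr_ge0// subr_ge0 ltW.
apply: le_trans (bound m _) _.
  rewrite m0/= ler_pdivrMr ?mulr_gt0//; apply: ler_pM => //; last exact: ltW.
  exact: le_trans c1 a1.
have -> : enorm (m *: lowpart j t + c *: highpart j t) = m * p * d.
  apply/eqP; rewrite -(@eqrXn2 _ 2) ?enorm_ge0//.
  rewrite enorm_split -/p -/q -mE; apply/eqP.
  by rewrite !exprMn rE; ring.
have -> : (a - m) * (p / d) + m * p * d = (a / d) * p + (c * (r / d)) * q.
  have -> : c * (r / d) * q = m * (r * p) * r / d by rewrite mE; ring.
  rewrite (_ : m * (r * p) * r / d = m * p * r ^+ 2 / d); last by ring.
  by rewrite rE; field; rewrite gt_eqF.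
apply: cauchy2; rewrite ?pq//.
rewrite !exprMn aE cE rE exprVn.
rewrite (_ : _ + _ = 1)//; field; rewrite gt_eqF//.
Qed.

End extremal_position.

(** * John's theorem and large vectors in extremal position *)

Section extremal_consequences.
Context {R : realType} {V : normedModType R}.

Lemma bernoulli_ineq (x : R) m : -1 <= x -> 1 + m%:R * x <= (1 + x) ^+ m.
Proof.
move=> x1; elim: m => [|m IH]; first by rewrite mul0r addr0 expr0.
rewrite exprS -natr1.
have : (1 + x) * (1 + m%:R * x) <= (1 + x) * (1 + x) ^+ m.
  by rewrite ler_wpM2l//; lra.
have : 0 <= m%:R * (x ^+ 2) by rewrite mulr_ge0// sqr_ge0.
nra.
Qed.

Lemma lowpart1 n (t : 'rV[R]_n.+1) : lowpart 1 t = t 0 0 *: delta_mx 0 0.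
Proof.
apply/rowP => -[[|i] i1]; rewrite !mxE/=; last by rewrite mulr0.
by rewrite mulr1; congr (t 0 _); apply: val_inj.
Qed.

(* John's theorem: a direction with too small a norm could be used to stretch
   the ellipsoid, with s = eta / d^2, beyond the maximal volume. *)
Lemma extremal_lower_bound (eta : R) n (b : 'I_n -> V) t :
  0 < eta <= 1 -> extremal (eta ^+ 2 / 16) b ->
  enorm t <= Num.sqrt n%:R * (1 + eta) * `|comb b t|.
Proof.
move=> /andP[eta0 eta1]; case: n b t => [|n] b t bE.
  by rewrite /enorm big_ord0 sqrtr0 mul0r.
rewrite leNgt; apply/negP => lt_t.
have t0 : 0 < enorm t.
  by apply: le_lt_trans lt_t; rewrite !mulr_ge0 ?sqrtr_ge0 ?addr_ge0 ?(ltW eta0).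
set d := Num.sqrt n.+1%:R * (1 + eta) in lt_t.
have dE : d ^+ 2 = n.+1%:R * (1 + eta) ^+ 2 by rewrite exprMn sqr_sqrtr.
have n1 : 1 <= n.+1%:R :> R by rewrite ler1n.
have q1n : 1 <= Num.sqrt n.+1%:R :> R by rewrite -[leLHS]sqrtr1 ler_wsqrtr.
have d1 : 1 < d by rewrite /d; nra.
have d0 : 0 < d by lra.
pose u := (enorm t)^-1 *: t.
have u1 : enorm u = 1 by rewrite enormZ gtr0_norm ?invr_gt0// mulVf// gt_eqF.
have du : `|comb b u| <= 1 / d.
  rewrite linearZ/= normrZ gtr0_norm ?invr_gt0// ler_pdivlMr// -mulrA.
  by rewrite ler_pdivrMl// mulr1 mulrC ltW.
(* With the short direction [u] placed at index 0, stretching it is a diagonal operation with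
   [j = 1]. *)
have [//|b' [b'E b'0 _]] := @extremal_rotate _ _ _ _ b u 0 bE u1.
pose s := eta / d ^+ 2.
have d21 : 1 < d ^+ 2 by nra.
have sd : s * d ^+ 2 = eta by rewrite divfK// gt_eqF//; lra.
have s0 : 0 <= s by rewrite divr_ge0// ?ltW//; lra.
have s1 : s <= 1 by nra.
have /b'E.2 : ellipsoid b' (split_diag 1 (Num.sqrt (1 + s * (d ^+ 2 - 1)))
    (Num.sqrt (1 - s))).
  apply: stretched_ellipsoid => //; [exact: b'E.1|by rewrite s0|] => v.
  rewrite lowpart1 linearZ/= comb_delta normrZ b'0 enormZ enorm_delta mulr1.
  by rewrite ler_wpM2l// -div1r.
rewrite det_split_diag// expr1 subn1/=.
have q1 : 0 <= 1 + s * (d ^+ 2 - 1) by rewrite addr_ge0// mulr_ge0// subr_ge0 ltW.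
have q2 : 0 <= 1 - s by rewrite subr_ge0.
rewrite ger0_norm ?mulr_ge0 ?exprn_ge0 ?sqrtr_ge0//; apply/negP.
have tau0 : 0 <= 1 + eta ^+ 2 / 16 by rewrite addr_ge0// divr_ge0// sqr_ge0.
(* The squared determinant is [(1 + s (d^2 - 1)) (1 - s)^n], in dimension [n.+1]. Bernoulli's
   inequality and [s d^2 = eta] bound it below by [1 + s n.+1 eta]. As
   [s n.+1 = eta / (1 + eta)^2 >= eta / 4], this is at least [1 + eta^2 / 4], which exceeds
   [(1 + eta^2 / 16)^2]. *)
rewrite -ltNge -(@ltr_pXn2r _ 2) ?nnegrE ?mulr_ge0 ?exprn_ge0 ?sqrtr_ge0//.
rewrite [ltRHS]exprMn -exprM mulnC exprM !sqr_sqrtr//.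
have := @bernoulli_ineq (- s) n.
rewrite lerN2 mulrN => /(_ s1) /(ler_wpM2l q1).
apply: lt_le_trans.
have nE : n.+1%:R = 1 + n%:R :> R by rewrite nat1r.
have n0 : 0 <= n%:R :> R by [].
have lhs : (1 + eta ^+ 2 / 16) ^+ 2 < 1 + eta ^+ 2 / 4.
  have : 0 < eta ^+ 2 <= 1 by apply/andP; nra.
  by move: (eta ^+ 2) => y /andP[y0 y1]; nra.
apply: lt_le_trans lhs _.
have key : s * (n.+1%:R * eta) >= eta ^+ 2 / 4.
  have : s * (n.+1%:R * (1 + eta) ^+ 2) = eta by rewrite -dE.
  have : 0 <= s * n.+1%:R by rewrite mulr_ge0.
  rewrite mulrA [s * (_ * eta)]mulrA; move: (s * n.+1%:R) => y y0 ye.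
  have : y * (1 + eta) ^+ 2 <= y * 4 by rewrite ler_wpM2l//; nra.
  nra.
apply: le_trans (_ : 1 + s * (n.+1%:R * eta) <= _); first by lra.
have -> : (1 + s * (d ^+ 2 - 1)) * (1 - n%:R * s) =
    1 + s * (d ^+ 2 - n.+1%:R - (s * d ^+ 2) * n%:R + s * n%:R).
  by rewrite nE; ring.
rewrite lerD2l ler_wpM2l// sd dE.
have : 0 <= s * n%:R by rewrite mulr_ge0.
have : 0 <= n.+1%:R * eta ^+ 2 by rewrite mulr_ge0// sqr_ge0.
by rewrite nE; nra.
Qed.

(** Otherwise the norm is at most [1 - eta] times the Euclidean norm on all upper coordinates. Then
    shrinking the [j] lower axes by [eta / 2] and stretching the others by [q] stays inside the unit
    ball, while the determinant is at least [(eta / 2)^n q^l > 2], against extremality with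
    [tau = 1]. *)
Lemma exists_large_vector (eta : R) n l (b : 'I_(n + l) -> V) j :
  0 < eta < 1 -> (j < n)%N -> extremal 1 b ->
  2 < (eta / 2) ^+ n * ((1 - eta / 2) / (1 - eta)) ^+ l ->
  exists t : 'rV[R]_(n + l), [/\ enorm t = 1,
    forall i : 'I_(n + l), (i < j)%N -> t 0 i = 0 & 1 - eta <= `|comb b t|].
Proof.
move=> /andP[eta0 eta1] jn bE; set q := _ / (1 - eta) => lq.
have q1 : 1 <= q by rewrite ler_pdivlMr; lra.
apply: contrapT => /forallNP nt.
have small t : `|comb b (highpart j t)| <= (1 - eta) * enorm (highpart j t).
  have [->|h0] := eqVneq (highpart j t) 0.
    by rewrite linear0 normr0 mulr_ge0 ?enorm_ge0//; lra.
  have e0 := enorm_gt0 h0; set e := enorm _ in e0 *.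
  rewrite leNgt; apply/negP => lt_e; apply: (nt (e^-1 *: highpart j t)).
  split=> [|i ij|].
  - by rewrite enormZ gtr0_norm ?invr_gt0// mulVf// gt_eqF.
  - by rewrite !mxE ij mulr0.
  by rewrite linearZ/= normrZ gtr0_norm ?invr_gt0// mulrC ler_pdivlMr// ltW.
have /bE.2 : ellipsoid b (split_diag j (eta / 2) q).
  move=> t; rewrite mul_split_diag linearD/= [comb b (_ *: _)]linearZ/=.
  rewrite [comb b (q *: _)]linearZ/=; apply: le_trans (ler_normD _ _) _.
  have normZ (x : R) (v : V) : 0 <= x -> `|x *: v| = x * `|v|.
    by move=> x0; rewrite normrZ ger0_norm.
  have q0 : 0 <= q by apply: le_trans q1.
  have r0 : 0 <= eta / 2 by rewrite divr_ge0// ltW.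
  rewrite !normZ//.
  apply: (@le_trans _ _ (eta / 2 * enorm (lowpart j t) +
      (1 - eta / 2) * enorm (highpart j t))).
    apply: lerD.
      by rewrite ler_wpM2l// (extremal_norm_le _ bE).
    have -> : 1 - eta / 2 = q * (1 - eta) by rewrite divfK// gt_eqF//; lra.
    by rewrite -[leRHS]mulrA ler_wpM2l.
  (* The coefficients satisfy [(eta / 2)^2 + (1 - eta / 2)^2 <= 1]. *)
  apply: cauchy2; first exact: enorm_ge0.
    by have := mulr_gt0 eta0 eta0; nra.
  by have := enorm_split j t 1 1; rewrite !scale1r !mul1r -split_lowhigh => ->.
apply/negP; rewrite -ltNge (_ : 1 + 1 = 2)//; apply: lt_le_trans lq _.
rewrite det_split_diag ?(leq_trans (ltnW jn)) ?leq_addr//.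
have r0 : 0 <= eta / 2 by rewrite divr_ge0// ltW.
rewrite ger0_norm; last by rewrite mulr_ge0 ?exprn_ge0 ?(le_trans _ q1).
apply: ler_pM; rewrite ?exprn_ge0 ?(le_trans _ q1)//.
  by rewrite ler_wiXn2l ?(ltnW jn)//; lra.
by rewrite ler_weXn2l// -addnBAC ?leq_addl// ltnW.
Qed.

End extremal_consequences.

(** * The Dvoretzky-Rogers lemma *)

Section dvoretzky_rogers.
Context {R : realType}.

Lemma lin_indep_extend (V : lmodType R) n (b : 'I_n -> V) (y : V) :
  lin_indep b -> ~ span_of b y ->
  lin_indep (fun i : 'I_n.+1 => if unlift ord0 i is Some j then b j else y).
Proof.
move=> bI yb a; rewrite big_ord_recl unlift_none.
under eq_bigr => i _ do rewrite liftK.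
move=> a0; have {}yb : a ord0 = 0.
  apply/eqP/negPn/negP => a00; apply: yb.
  exists (fun i => - (a ord0)^-1 * a (lift ord0 i)).
  under eq_bigr => i _ do rewrite -scalerA.
  rewrite -scaler_sumr; move/eqP: a0; rewrite addr_eq0 => /eqP a0.
  by rewrite scaleNr -scalerN -a0 scalerA mulVf// scale1r.
move: a0; rewrite yb scale0r add0r => /bI al i.
by case: (unliftP ord0 i) => [j ->|->].
Qed.

Lemma infdim_lin_indep (V : lmodType R) n :
  ~ findim_subspace [set: V] -> exists b : 'I_n -> V, lin_indep b.
Proof.
move=> Vinf; elim: n => [|n [b bI]]; first by exists (fun=> 0) => a _ [].
have [y yb] : exists y, ~ span_of b y.
  apply/existsNP => bV; apply: Vinf; exists n; exists b => //.
  by apply/seteqP; split=> // y _; exact: bV.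
by eexists; exact: lin_indep_extend bI yb.
Qed.

(** Work in dimension [n + l], where the many spare dimensions [l] make the volume gain of
    [exists_large_vector] exceed 2. Large vectors are then found one at a time and rotated into the
    first [n] places of an extremal basis. *)
Lemma dvoretzky_rogers (Y : normedModType R) n (eta : R) :
  ~ findim_subspace [set: Y] -> 0 < eta < 1 ->
  exists a : 'I_n -> Y, (forall t, `|comb a t| <= enorm t) /\
    forall i, 1 - eta <= `|a i|.
Proof.
move=> Yinf eta01; have /andP[eta0 eta1] := eta01.
have [l lq] : exists l, 2 < (eta / 2) ^+ n * ((1 - eta / 2) / (1 - eta)) ^+ l.
  set q := _ / (1 - eta); have q1 : 0 < q - 1.
    by rewrite subr_gt0 ltr_pdivlMr; lra.
  have p0 : 0 < (eta / 2) ^+ n by rewrite exprn_gt0// divr_gt0.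
  (* By Bernoulli's inequality [q^l] is at least [1 + l (q - 1)], and this [l] makes [l (q - 1)]
     exceed [2 / (eta / 2)^n]. *)
  exists (Num.truncn (2 / (eta / 2) ^+ n / (q - 1))).+1.
  rewrite mulrC -ltr_pdivrMr//; have -> : q = 1 + (q - 1) by ring.
  apply: lt_le_trans (bernoulli_ineq _ _); last by lra.
  apply: (@lt_trans _ _ (2 / (eta / 2) ^+ n + 1)); first by rewrite ltrDl.
  rewrite addrC ltrD2l -ltr_pdivrMr//; have -> : 1 + (q - 1) - 1 = q - 1 by ring.
  exact: truncnS_gt.
have [e /(@exists_extremal _ _ 1 _ _ ltr01)[A _ eE]] := infdim_lin_indep (n + l) Yinf.
have /(_ n (leqnn n))[b [bE b1]] : forall m, (m <= n)%N ->
    exists b : 'I_(n + l) -> Y, extremal 1 b /\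
      forall i : 'I_(n + l), (i < m)%N -> 1 - eta <= `|b i|.
  elim=> [_|m IH mn]; first by exists (fun i => comb e (row i A)); split.
  have [b [bE b1]] := IH (ltnW mn).
  have [t [t1 tm bt]] := exists_large_vector eta01 mn bE lq.
  have mnl : (m < n + l)%N by exact: leq_trans mn (leq_addr _ _).
  have [b' [b'E b't b'b]] := @extremal_rotate _ _ _ _ b t (Ordinal mnl) bE t1 tm.
  exists b'; split=> // i; rewrite ltnS leq_eqVlt => /orP[/eqP im|im].
    by rewrite (_ : i = Ordinal mnl) ?b't//; exact: val_inj.
  by rewrite b'b//; exact: b1.
exists (fun i => b (lshift l i)); split=> [t|i]; last by apply: b1; rewrite /= ltn_ord.
(* Padding [t] with zeros restricts the ellipsoid to the first [n] vectors. *)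
have := extremal_norm_le (row_mx t 0) bE.
rewrite /comb /enorm !big_split_ord/=.
under eq_bigr => i _ do rewrite row_mxEl.
rewrite [X in _ + X]big1 => [|i _]; last by rewrite row_mxEr mxE scale0r.
rewrite addr0; under [in leRHS]eq_bigr => i _ do rewrite row_mxEl.
rewrite [X in Num.sqrt (_ + X)]big1 ?addr0// => i _.
by rewrite row_mxEr mxE expr0n.
Qed.

End dvoretzky_rogers.

(** * Bochner spaces over a finite probability space *)

Section finite_probability.
Context {R : realType} {I : finType}.
Implicit Types (w : I -> {nonneg R}).

(* The points of I are placed at the integers below #|I|, because nat carries
   a canonical discrete sigma-algebra. *)
Definition spread (T : Type) (x0 : T) (g : I -> T) (k : nat) : T :=
  if insub k is Some j then g (@enum_val I xpredT j) else x0.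

Lemma spread_rank (T : Type) (x0 : T) (g : I -> T) i :
  spread x0 g (enum_rank i) = g i.
Proof. by rewrite /spread valK enum_rankK. Qed.

Lemma spread_cases (T : Type) (x0 : T) (g : I -> T) k :
  (exists i, spread x0 g k = g i) \/ spread x0 g k = x0.
Proof.
by rewrite /spread; case: insubP => [j _ _|_]; [left; eexists|right].
Qed.

Definition finprob w (w1 : \sum_i (w i)%:num = 1) : set nat -> \bar R :=
  msum (fun k => mscale (spread (0%:nng)%R w k) \d_k) #|I|.

HB.instance Definition _ w (w1 : \sum_i (w i)%:num = 1) :=
  Measure.on (finprob w1).

Lemma sum_ord_enum (M : nmodType) (h : nat -> M) :
  \sum_(k < #|I|) h k = \sum_(i : I) h (enum_rank i).
Proof.
rewrite (reindex (@enum_val I xpredT)) /=; last first.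
  by apply: onW_bij; exact: enum_val_bij.
by apply: eq_bigr => k _; rewrite enum_valK.
Qed.

Section fixed_weights.
Context (w : I -> {nonneg R}) (w1 : \sum_i (w i)%:num = 1).
Local Open Scope ereal_scope.

Lemma finprobE A :
  finprob w1 A = \sum_i (w i)%:num%:E * \d_(nat_of_ord (enum_rank i)) A.
Proof.
rewrite /finprob /msum (sum_ord_enum (fun k => mscale (spread (0%:nng)%R w k) \d_k A)).
by apply: eq_bigr => i _; rewrite /mscale/= spread_rank.
Qed.

Lemma finprob_setT : finprob w1 [set: nat] = 1.
Proof.
rewrite finprobE -w1 -sumEFin; apply: eq_bigr => i _.
by rewrite diracT mule1.
Qed.

HB.instance Definition _ :=
  @Measure_isProbability.Build _ _ R (finprob w1) finprob_setT.

Lemma finprob_integral (f : nat -> \bar R) : (forall k, 0 <= f k) ->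
  \int[finprob w1]_k f k = \sum_i (w i)%:num%:E * f (enum_rank i).
Proof.
move=> f0; have mf (D : set nat) : measurable_fun D f by move=> *; exact: Logic.I.
rewrite ge0_integral_measure_sum//=.
rewrite (sum_ord_enum (fun k => \int[mscale (spread (0%:nng)%R w k) \d_k]_x f x)).
apply: eq_bigr => i _; rewrite ge0_integral_mscale// spread_rank.
by rewrite integral_dirac// diracT mul1e.
Qed.

Lemma finprob_atom (P : nat -> Prop) i : (0 < (w i)%:num)%R ->
  (\forall k \ae finprob w1, P k) -> P (enum_rank i).
Proof.
move=> wi [A [_ A0 PA]]; apply: contrapT => nP.
have /eqP := A0; apply/negP; rewrite gt_eqF// finprobE.
rewrite (bigD1 i)//= diracE mem_set ?mule1; last exact: PA.
rewrite (@lt_le_trans _ _ (w i)%:num%:E)// ?lte_fin// leeDl//.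
by apply: sume_ge0 => j _; rewrite mule_ge0.
Qed.

(** Finite sets of integers, coded by sequences, form a countable family, and every [B] agrees up to
    a null set with its trace on the atoms. *)
Lemma finprob_separable : separable_measure (finprob w1).
Proof.
exists (fun k => [set x | x \in odflt [::] (unpickle k : option (seq nat))]).
split=> // B _ e e0.
exists (pickle [seq x <- iota 0 #|I| | `[< B x >]]); rewrite pickleK/=.
rewrite finprobE big1 ?lte_fin// => i _.
rewrite diracE memNset ?mule0//= => -[[] /=|[] /=].
  by move=> Bi; rewrite mem_filter mem_iota/= ltn_ord andbT => /negP/asboolP.
by rewrite mem_filter => /andP[/asboolP].
Qed.

Section functions_on_atoms.
Context {E : normedModType R}.
Implicit Types g h : I -> E.

Lemma spread_Linfty g : spread 0%R g \in @Linfty_pred _ _ _ (finprob w1) E.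
Proof.
apply/asboolP; split.
  exists (fun _ => spread 0%R g) => [_|t]; last exact: cvg_cst.
  split=> //; apply: (@sub_finite_set _ _ ([set 0%R] `|` range g)).
    move=> _ [k _ <-]; have [[i ->]| ->] := spread_cases 0%R g k; last by left.
    by right; exists i.
  by rewrite finite_setU; split=> //; exact: finite_image.
rewrite bochner_normyE; apply: (@le_lt_trans _ _ (\sum_i `|g i|)%:E); last exact: ltry.
apply/ess_supP; apply: nearW => k; rewrite lee_fin.
have [[i ->]| ->] := spread_cases 0%R g k; last by rewrite normr0 sumr_ge0.
by rewrite (bigD1 i)//= lerDl sumr_ge0.
Qed.

(** The default value 0 off the atoms keeps the function inside every subspace containing the values
    of [g], and keeps the construction linear in [g]. *)
Definition atomic_Linfty g : Linfty (finprob w1) E :=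
  \pi_(Linfty (finprob w1) E)%qT (MkLinftyFun (spread_Linfty g)).

Lemma atomic_LinftyP (a : R) g h :
  atomic_Linfty (fun i => a *: g i + h i)%R = (a *: atomic_Linfty g + atomic_Linfty h)%R.
Proof.
rewrite /atomic_Linfty -Linfty_piZ -Linfty_piD; congr (\pi_ _ _)%qT.
apply: val_inj; apply/funext => k; rewrite /= /spread.
change ((if insub k is Some j then a *: g (@enum_val I xpredT j) + h (@enum_val I xpredT j) else 0) =
 a *: (if insub k is Some j then g (@enum_val I xpredT j) else 0) +
  (if insub k is Some j then h (@enum_val I xpredT j) else 0))%R.
by case: insubP => // _; rewrite scaler0 addr0.
Qed.

Lemma atomic_Linfty_in (Z : set E) g : Z 0%R -> (forall i, Z (g i)) ->
  Linfty_in (finprob w1) Z (atomic_Linfty g).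
Proof.
move=> Z0 Zg; exists (MkLinftyFun (spread_Linfty g)) => // k /=.
by have [[i ->]| ->] := spread_cases 0%R g k.
Qed.

Hypothesis w_gt0 : forall i, (0 < (w i)%:num)%R.

(** Representatives of one class differ on a null set only, which contains no atom because all
    weights are positive. Norms can thus be read off from [g]. *)
Lemma repr_atomic_Linfty g i : repr (atomic_Linfty g) (enum_rank i) = g i.
Proof.
have := Linfty_reprK (MkLinftyFun (spread_Linfty g)).
by move=> /(finprob_atom (w_gt0 i)) ->; exact: spread_rank.
Qed.

Lemma atomic_Linfty_norm_le g (B : R) : (0 <= B)%R ->
  (forall i, `|g i| <= B)%R -> Lp_norm +oo (atomic_Linfty g) <= B%:E.
Proof.
move=> B0 gB; rewrite Lp_normyE.
have -> : `|atomic_Linfty g|%R = Linfty_norm (atomic_Linfty g) by [].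
rewrite Linfty_normE bochner_normyE; apply/ess_supP; apply: nearW => k /=.
rewrite lee_fin; have [[i ->]| ->] := spread_cases 0%R g k; first exact: gB.
by rewrite normr0.
Qed.

Lemma atomic_Linfty_norm_ge g i : `|g i|%:E <= Lp_norm +oo (atomic_Linfty g).
Proof.
rewrite /Lp_norm bochner_normyE -repr_atomic_Linfty.
exact: (finprob_atom (w_gt0 i) (ess_sup_ge _ _)).
Qed.

Lemma atomic_L1_norm g :
  Lp_norm 1 (atomic_Linfty g) = (\sum_i (w i)%:num * `|g i|)%:E.
Proof.
rewrite /Lp_norm /bochner_norm Lnorm1 finprob_integral// -sumEFin.
by apply: eq_bigr => i _; rewrite EFinM/= normr_id repr_atomic_Linfty.
Qed.

End functions_on_atoms.
End fixed_weights.
End finite_probability.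

(** * Embeddings *)

Section linear_embeddings.
Context {R : realType}.

Lemma le_opnorm (V U : normedModType R) (W : set V) (S : V -> U) (a : R) u :
  (forall c v, W v -> W (c *: v)) ->
  (forall c v, W v -> S (c *: v) = c *: S v) ->
  (opnorm_on W S <= a%:E)%E -> W u -> `|S u| <= a * `|u|.
Proof.
move=> WZ SZ Sa Wu; have [->|u0] := eqVneq u 0.
  have := SZ 0 u Wu; rewrite !scale0r => ->.
  by rewrite !normr0 mulr0.
have nu : 0 < `|u| by rewrite normr_gt0.
rewrite -ler_pdivrMr// mulrC -[X in X * _]ger0_norm ?invr_ge0// -normrZ -SZ//.
rewrite -lee_fin; apply: le_trans Sa; apply: ereal_sup_ubound.
exists (`|u|^-1 *: u) => //; split; first exact: WZ.
by rewrite /unit_ball/= normrZ ger0_norm ?invr_ge0// mulVf// gt_eqF.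
Qed.

Lemma opnorm_gt0 (V U : normedModType R) (W : set V) (S : V -> U) u :
  (forall c v, W v -> W (c *: v)) ->
  (forall c v, W v -> S (c *: v) = c *: S v) ->
  W u -> S u != 0 -> (0 < opnorm_on W S)%E.
Proof.
move=> WZ SZ Wu Su0; have u0 : u != 0.
  apply: contraNneq Su0 => u0; have := SZ 0 u Wu.
  by rewrite u0 !scale0r => ->.
apply: (@lt_le_trans _ _ `|S (`|u|^-1 *: u)|%:E).
  by rewrite lte_fin normr_gt0 SZ// scaler_eq0 negb_or invr_eq0 normr_eq0 u0.
apply: ereal_sup_ubound; exists (`|u|^-1 *: u) => //; split; first exact: WZ.
by rewrite /unit_ball/= normrZ ger0_norm ?invr_ge0// mulVf// normr_eq0.
Qed.

(** A nonzero vector of [W] makes both operator norms positive; as their product is at most the real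
    number [K], neither can be infinite. *)
Lemma lin_distortion_bounds (V U : normedModType R) (W : set V) (S : V -> U)
    (K : R) :
  W 0 -> (forall (c : R) u v, W u -> W v -> W (c *: u + v)) ->
  (exists2 w, W w & w != 0) ->
  linear_on W S -> {in W &, injective S} -> (lin_distortion W S <= K%:E)%E ->
  exists a b : R, [/\ 0 < a, 0 < b, a * b <= K,
    forall w, W w -> `|S w| <= a * `|w| & forall w, W w -> `|w| <= b * `|S w|].
Proof.
move=> W0 Wlin [w Ww w0] Slin Sinj SK.
have S0 : S 0 = 0.
  have := Slin 1 0 0 W0 W0; rewrite !scale1r addr0 => /esym/eqP.
  by rewrite -subr_eq0 addrK => /eqP.
have WZ (c : R) v : W v -> W (c *: v) by move=> Wv; rewrite -[_ *: _]addr0; exact: Wlin.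
have SZ (c : R) v : W v -> S (c *: v) = c *: S v.
  by move=> Wv; rewrite -[in LHS](addr0 (c *: v)) Slin// S0 addr0.
have pS v : W v -> pinv W S (S v) = v.
  by move=> Wv; apply: pinvKV; rewrite ?inE.
have SWZ (c : R) y : (S @` W) y -> (S @` W) (c *: y).
  by move=> [v Wv <-]; exists (c *: v); rewrite ?SZ//; exact: WZ.
have pSZ (c : R) y : (S @` W) y -> pinv W S (c *: y) = c *: pinv W S y.
  by move=> [v Wv <-]; rewrite -SZ// !pS//; exact: WZ.
have Sw0 : S w != 0.
  by apply: contra_neq w0 => Sw; apply: Sinj; rewrite ?inE// S0.
have a0 := opnorm_gt0 WZ SZ Ww Sw0.
have b0 : (0 < opnorm_on (S @` W) (pinv W S))%E.
  by apply: (opnorm_gt0 SWZ pSZ (u := S w)); [exists w|rewrite pS].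
move: SK; rewrite /lin_distortion.
case aE : (opnorm_on W S) a0 => [a| |]// a0; last first.
  by rewrite gt0_mulye// leye_eq.
case bE : (opnorm_on _ _) b0 => [b| |]// b0; last first.
  by rewrite gt0_muley// leye_eq.
rewrite -EFinM !lee_fin => abK; exists a, b; split=> // v Wv.
  by apply: (le_opnorm WZ SZ) => //; rewrite aE.
rewrite -[in X in X <= _](pS v)//; by apply: (le_opnorm SWZ pSZ); rewrite ?bE.
Qed.

Lemma distortion_into_le (X Y : normedModType R) (A : set X) (phi : X -> Y)
    (r K : R) : 0 < r ->
  (forall u v, A u -> A v -> r * `|u - v| <= `|phi u - phi v| <= r * K * `|u - v|) ->
  (distortion_into Y A <= K%:E)%E.
Proof.
move=> r0 phiK; apply: ereal_inf_lbound; exists K => //.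
by exists phi; exists r.
Qed.

(** The range of [T] embeds into [Y] by the discretization property, and this embedding is composed
    with [T]. The constant [C] serves twice: it bounds the distortion of [T], and the ratio of the
    two norms on its range. This yields the product [C * f C]. *)
Lemma LB_discretization_embed (X : normedModType R) (Y : completeNormedModType R)
    (f : R -> R) (n : nat) d (Omega : measurableType d)
    (nu : probability Omega R) (Z : set Y) (T : X -> Linfty nu Y) (A B C : R) :
  LB_discretization Y f -> separable_measure nu -> findim_subspace Z ->
  has_dim [set: X] n -> (exists x : X, x != 0) -> linear T ->
  (forall x, Linfty_in nu Z (T x)) -> 0 < A -> 1 <= C -> B <= A * C ->
  (forall x, A * `|x| <= `|T x| <= B * `|x|) ->
  (forall x, (Lp_norm +oo (T x) <= C%:E * Lp_norm 1 (T x))%E) ->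
  (distortion_into Y [set: X] <= (C * f C)%:E)%E.
Proof.
move=> [f1 fLB] nuS Zfin [e eI eX] [x0 x00] Tlin TZ A0 C1 BAC TAB TC.
pose W := range T.
have T0 : T 0 = 0.
  have := Tlin 1 0 0; rewrite !scale1r addr0 => /esym/eqP.
  by rewrite -subr_eq0 addrK => /eqP.
have Tinj x : T x = 0 -> x = 0.
  move=> Tx; have /andP[+ _] := TAB x.
  by rewrite Tx normr0 pmulr_rle0// normr_le0 => /eqP.
have Tsum (I : Type) (r : seq I) (a : I -> R) (g : I -> X) :
    T (\sum_(i <- r) a i *: g i) = \sum_(i <- r) a i *: T (g i).
  elim: r => [|i r IH]; first by rewrite !big_nil.
  by rewrite !big_cons Tlin IH.
have TB x y : T (x - y) = T x - T y.
  by rewrite addrC -scaleN1r Tlin scaleN1r addrC.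
have Wfin : findim_subspace W.
  exists n; exists (fun i => T (e i)).
    by move=> a; rewrite -Tsum => /Tinj; exact: eI.
  apply/seteqP; split=> [_ [x _ <-]|_ [a ->]].
    have : span_of e x by rewrite -eX.
    by case=> a ->; exists a; rewrite Tsum.
  by exists (\sum_i a i *: e i); rewrite ?Tsum.
have fC := f1 _ C1.
have WZ : W `<=` Linfty_in nu Z by move=> _ [x _ <-]; exact: TZ.
have WC w : W w -> (Lp_norm +oo w <= C%:E * Lp_norm 1 w)%E.
  by move=> [x _ <-]; exact: TC.
have infS := fLB _ _ nu nuS C C1 Z Zfin W Wfin WZ WC.
have C0 : 0 < C by lra.
(* [embeddable] bounds an infimum that may not be attained. The slack [t / C] in the distortion of
   [S] becomes [t] after multiplication by [C]. *)
apply/lee_addgt0Pr => t t0.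
have lt_inf : (ereal_inf [set lin_distortion W S | S in
    [set S : Linfty nu Y -> Y | linear_on W S /\ {in W &, injective S}]]
    < (f C + t / C)%:E)%E.
  by apply: le_lt_trans infS _; rewrite lte_fin ltrDl divr_gt0.
have [_ [S [Slin Sinj] <-] /ltW SK] := ereal_inf_lt lt_inf.
have [|||a [b [a0 b0 abK Sa Sb]]] := lin_distortion_bounds _ _ _ Slin Sinj SK.
- by exists 0.
- by move=> c _ _ [x _ <-] [y _ <-]; exists (c *: x + y); rewrite ?Tlin.
- exists (T x0); first by exists x0.
  by apply: contra_neq x00; exact: Tinj.
apply: (@le_trans _ _ (C * (a * b))%:E).
  apply: (@distortion_into_le _ _ _ (S \o T) (A / b)); first exact: divr_gt0.
  move=> u v _ _ /=.
  have Wuv : W (T (u - v)) by exists (u - v).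
  have -> : S (T u) - S (T v) = S (T (u - v)).
    rewrite TB addrC -scaleN1r -Slin ?scaleN1r 1?addrC//; by eexists.
  have /andP[lo up] := TAB (u - v).
  apply/andP; split.
    by rewrite mulrAC ler_pdivrMr// (le_trans lo)// mulrC; exact: Sb.
  apply: le_trans (Sa _ Wuv) _.
  have -> : A / b * (C * (a * b)) * `|u - v| = a * (A * C * `|u - v|).
    by field; rewrite gt_eqF.
  rewrite ler_wpM2l ?(ltW a0)//; apply: le_trans up _.
  by rewrite ler_wpM2r.
rewrite -EFinD lee_fin; have -> : C * f C + t = C * (f C + t / C).
  by field; rewrite gt_eqF.
by rewrite ler_wpM2l// ltW.
Qed.

End linear_embeddings.

(** * The Euclidean space inside a Bochner space *)

Section spans.
Context {R : realType} {V : lmodType R}.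

Lemma span_of_lin n (b : 'I_n -> V) (c : R) u v :
  span_of b u -> span_of b v -> span_of b (c *: u + v).
Proof.
move=> [s ->] [t ->]; exists (fun i => c * s i + t i).
rewrite scaler_sumr -big_split/=; apply: eq_bigr => i _.
by rewrite scalerDl scalerA.
Qed.

Lemma span_of0 n (b : 'I_n -> V) : span_of b 0.
Proof. by exists (fun=> 0); rewrite big1// => i _; rewrite scale0r. Qed.

Lemma span_of_mem n (b : 'I_n -> V) i : span_of b (b i).
Proof.
exists (fun j => (j == i)%:R); rewrite (bigD1 i)//= eqxx scale1r big1 ?addr0//.
by move=> j /negbTE ->; rewrite scale0r.
Qed.

Lemma span_of_comb n (b : 'I_n -> V) m (u : 'I_m -> V) (t : 'I_m -> R) :
  (forall i, span_of b (u i)) -> span_of b (\sum_i t i *: u i).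
Proof.
move=> bu; elim/big_ind : _ => [|x y bx b_y|i _]; first exact: span_of0.
  by rewrite -[x]scale1r; exact: span_of_lin.
by rewrite -[_ *: _]addr0; apply: span_of_lin; [exact: bu|exact: span_of0].
Qed.

(** It supplies the finite-dimensional space [Z] in which the embedding of Euclidean space takes its
    values; [findim_subspace] asks for an independent spanning family. *)
Lemma exists_basis n (a : 'I_n -> V) :
  exists m, exists2 b : 'I_m -> V, lin_indep b & forall i, span_of b (a i).
Proof.
elim: n a => [|n IH] a; first by exists 0%N; exists (fun=> 0) => [t _ []|[]].
have [m [b bI ba]] := IH (fun i => a (lift ord0 i)).
have [b0|b0] := pselect (span_of b (a ord0)).
  by exists m; exists b => // i; case: (unliftP ord0 i) => [j ->|->].
pose b' (i : 'I_m.+1) := if unlift ord0 i is Some j then b j else a ord0.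
exists m.+1; exists b' => [|i]; first exact: lin_indep_extend.
case: (unliftP ord0 i) => [j ->|->]; last first.
  by have := span_of_mem b' ord0; rewrite /b' unlift_none.
have [t ->] := ba j; apply: span_of_comb => k.
by have := span_of_mem b' (lift ord0 k); rewrite /b' liftK.
Qed.

End spans.

Section hilbert_space_in_Linfty.
Context {R : realType}.

(** The family consists of the points of a grid of mesh [1 / m] that lie in the ball, the other grid
    points being replaced by 0. Rounding a unit vector [u] coordinatewise towards 0 stays in the
    ball and costs at most [1 / m] per coordinate in the scalar product with [u], hence at most
    [n / m <= eta] in all. *)
Lemma euclidean_ball_net n (eta : R) : 0 < eta ->
  exists (J : finType) (om : J -> 'rV[R]_n), (forall j, enorm (om j) <= 1) /\
    forall t, exists j, (1 - eta) * enorm t <= \sum_i t 0 i * om j 0 i.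
Proof.
move=> eta0; pose m := (Num.truncn (n%:R / eta)).+1.
have m0 : 0 < m%:R :> R by rewrite ltr0n.
have nm : n%:R / m%:R <= eta.
  by rewrite ler_pdivrMr// mulrC -ler_pdivrMr// ltW// truncnS_gt.
pose pt (g : {ffun 'I_n -> bool * 'I_m.+1}) : 'rV[R]_n :=
  \row_i ((-1) ^+ (g i).1 * ((g i).2%:R / m%:R)).
exists {ffun 'I_n -> bool * 'I_m.+1}; exists (fun g => if enorm (pt g) <= 1 then pt g else 0).
split=> [g|t].
  by case: ifP => // _; rewrite -(scale0r (0 : 'rV[R]_n)) enormZ normr0 mul0r.
have [->|/enorm_gt0 t0] := eqVneq t 0.
  exists [ffun=> (false, ord0)]; rewrite big1 => [|i _]; last by rewrite mxE mul0r.
  by rewrite -[X in enorm X](scale0r 0) enormZ normr0 mul0r mulr0.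
pose u : 'rV[R]_n := (enorm t)^-1 *: t.
have u1 : enorm u = 1 by rewrite enormZ gtr0_norm ?invr_gt0// mulVf// gt_eqF.
have um i : (Num.truncn (m%:R * `|u 0 i|)%R < m.+1)%N.
  rewrite ltnS -(ler_nat R); apply: le_trans (_ : m%:R * `|u 0 i| <= _).
    by rewrite truncn_le// mulr_ge0.
  by rewrite ler_piMr// -u1; exact: enorm_coord.
pose g := [ffun i => (u 0 i < 0, Ordinal (um i))].
have gu i : pt g 0 i = (-1) ^+ (u 0 i < 0)%R * ((Num.truncn (m%:R * `|u 0 i|))%:R / m%:R).
  by rewrite mxE ffunE.
have ptg : enorm (pt g) <= 1.
  rewrite -u1 ler_wsqrtr// ler_sum// => i _.
  rewrite gu exprMn sqrr_sign mul1r -[leRHS]real_normK ?num_real//.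
  rewrite lerXn2r ?nnegrE ?divr_ge0// ler_pdivrMr// mulrC.
  by rewrite truncn_le// mulr_ge0.
exists g; rewrite ptg.
have -> : \sum_i t 0 i * pt g 0 i = enorm t * \sum_i u 0 i * pt g 0 i.
  rewrite mulr_sumr; apply: eq_bigr => i _.
  by rewrite [u 0 i]mxE !mulrA mulfV ?mul1r// gt_eqF.
rewrite mulrC ler_wpM2l ?enorm_ge0//.
apply: (@le_trans _ _ (\sum_i (u 0 i ^+ 2 - 1 / m%:R))).
  rewrite sumrB -sqr_enorm u1 expr1n lerD2l lerN2.
  by rewrite sumr_const card_ord div1r -[leLHS]mulr_natl.
apply: ler_sum => i _.
rewrite gu mulrA [u 0 i * _]mulrC -normrEsign -[u 0 i ^+ 2]real_normK ?num_real//.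
have := enorm_coord u i; rewrite u1; move: `|u 0 i| (normr_ge0 (u 0 i)) => y y0 y1.
have : y * m%:R <= (Num.truncn (m%:R * y)).+1%:R by rewrite mulrC ltW// truncnS_gt.
have : 0 <= 1 / m%:R :> R by rewrite divr_ge0.
rewrite -ler_pdivlMr// -natr1 mulrDl; move: (_ / _) (1 / _) => p q q0 ypq.
have : y * y <= y * (p + q) by rewrite ler_wpM2l.
nra.
Qed.

(** Pair each choice of signs with the one where sign [j] is flipped. The two vectors differ by
    [2 t_j a_j] up to sign, so their norms add up to at least [2 |t_j| |a_j|]. *)
Lemma sign_average (V : normedModType R) n (a : 'I_n -> V) (t : 'rV[R]_n) j :
  `|t 0 j| * `|a j| <= (\sum_(s : {ffun 'I_n -> bool})
    `|comb a (\row_i ((-1) ^+ s i * t 0 i))|) / (2 ^ n)%:R.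
Proof.
rewrite ler_pdivlMr ?ltr0n ?expn_gt0//.
pose N (s : {ffun 'I_n -> bool}) := `|comb a (\row_i ((-1) ^+ s i * t 0 i))|.
pose flip (s : {ffun 'I_n -> bool}) := [ffun i => s i (+) (i == j)].
have flipK : involutive flip.
  by move=> s; apply/ffunP => i; rewrite !ffunE -addbA addbb addbF.
have NN s : 2 * (`|t 0 j| * `|a j|) <= N s + N (flip s).
  have -> : 2 * (`|t 0 j| * `|a j|) = `|comb a (\row_i ((-1) ^+ s i * t 0 i))
      - comb a (\row_i ((-1) ^+ flip s i * t 0 i))|.
    rewrite -linearB/= /comb (bigD1 j)//= big1 ?addr0 => [|i ij].
      rewrite !mxE ffunE eqxx addbT signrN mulNr opprK -mulr2n normrZ normrMn.
      by rewrite normrM normr_sign mul1r [RHS]mulrnAl mulr_natl.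
    by rewrite !mxE ffunE (negbTE ij) addbF subrr scale0r.
  exact: ler_normB.
rewrite -(@ler_pM2l _ 2)//.
have -> : 2 * \sum_s N s = \sum_s (N s + N (flip s)).
  rewrite big_split/= [X in _ = _ + X](_ : _ = \sum_s N s); first by rewrite mulr2n mulrDl mul1r.
  by rewrite [RHS](reindex_inj (inv_inj flipK)).
apply: le_trans (ler_sum _ (fun s _ => NN s)).
by rewrite sumr_const card_ffun card_bool card_ord -[leRHS]mulr_natr !mulrA.
Qed.
End hilbert_space_in_Linfty.

Section hilbert_embedding.
Context {R : realType}.

(* On the atoms indexed by signs, the norms of [\sum_i e_i t_i a_i] average to at
   least [max_i |t_i| |a_i|]; the atoms indexed by a net carry little mass, and
   only serve to make the essential supremum comparable to [enorm t]. *)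
Lemma euclidean_in_Linfty (Y : normedModType R) n (eta : R) :
  ~ findim_subspace [set: Y] -> (0 < n)%N -> 0 < eta < 1 ->
  exists (d : measure_display) (Omega : measurableType d)
    (nu : probability Omega R), separable_measure nu /\
  exists2 Z : set Y, findim_subspace Z &
  exists T : 'rV[R]_n -> Linfty nu Y,
  [/\ linear T, forall t, Linfty_in nu Z (T t),
      forall t, (1 - eta) ^+ 2 * enorm t <= `|T t| <= enorm t &
      forall t, (((1 - eta) ^+ 2 * enorm t)%:E
        <= (Num.sqrt n%:R)%:E * Lp_norm 1 (T t))%E].
Proof.
move=> Yinf n0 eta01; have /andP[eta0 eta1] := eta01.
have [a [a_le a_ge]] := dvoretzky_rogers n Yinf eta01.
have [J [om [om_le om_ge]]] := euclidean_ball_net n eta0.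
have J0 : (0 < #|J|)%N by have [j _] := om_ge 0; apply/card_gt0P; exists j.
have [m [e eI ea]] := exists_basis a.
pose S : finType := {ffun 'I_n -> bool}.
have wS0 : 0 < (1 - eta) / (2 ^ n)%:R.
  by rewrite divr_gt0 ?subr_gt0// ltr0n expn_gt0.
have wJ0 : 0 < eta / #|J|%:R by rewrite divr_gt0// ltr0n.
(* The sign atoms share the mass [1 - eta] equally, and the net atoms share [eta]. *)
pose w (i : S + J) : {nonneg R} :=
  if i is inl _ then NngNum (ltW wS0) else NngNum (ltW wJ0).
have w0 i : 0 < (w i)%:num by case: i.
have w1 : \sum_i (w i)%:num = 1.
  rewrite big_sumType/= !sumr_const card_ffun card_bool card_ord.
  rewrite -[X in X + _]mulr_natr -[X in _ + X]mulr_natr.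
  by rewrite !divfK ?subrK// pnatr_eq0 -lt0n// expn_gt0.
pose F (t : 'rV[R]_n) (i : S + J) : Y := match i with
  | inl s => comb a (\row_i ((-1) ^+ s i * t 0 i))
  | inr j => (\sum_i t 0 i * om j 0 i) *: a (Ordinal n0)
  end.
have a1 i : `|a i| <= 1 by rewrite -comb_delta -(enorm_delta i).
have signed_enorm (s : S) (t : 'rV[R]_n) : enorm (\row_i ((-1) ^+ s i * t 0 i)) = enorm t.
  congr Num.sqrt; apply: eq_bigr => i _.
  by rewrite mxE exprMn sqrr_sign mul1r.
have FZ t i : span_of e (F t i).
  case: i => [s|j] /=; first by apply: span_of_comb.
  by rewrite -[_ *: _]addr0; apply: span_of_lin => //; exact: span_of0.
have Flin (c : R) t u : F (c *: t + u) = fun i => c *: F t i + F u i.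
  apply/funext => -[s|j] /=.
    rewrite -linearP; congr comb; apply/rowP => i; rewrite !mxE; ring.
  rewrite scalerA -scalerDl; congr (_ *: _); rewrite mulr_sumr -big_split/=.
  by apply: eq_bigr => i _; rewrite !mxE; ring.
have F_le t i : `|F t i| <= enorm t.
  case: i => [s|j] /=; first by rewrite -(signed_enorm s).
  rewrite normrZ -[leRHS]mulr1 ler_pM//.
  apply: le_trans (enorm_cauchy _ _) _.
  by rewrite -[leRHS]mulr1 ler_wpM2l// enorm_ge0.
(* One factor [1 - eta] comes from the net, the other from the norm of the first [a_i]. *)
have F_ge t : exists i, (1 - eta) ^+ 2 * enorm t <= `|F t i|.
  have [j tj] := om_ge t; exists (inr j) => /=.
  rewrite normrZ expr2 mulrAC; apply: ler_pM => //.
  - by rewrite mulr_ge0 ?enorm_ge0// subr_ge0 ltW.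
  - by rewrite subr_ge0 ltW.
  by apply: le_trans tj _; exact: ler_norm.
(* Here one factor [1 - eta] is the mass of the sign atoms, the other bounds the norms of the [a_i];
   [sqrt n] compares [|t|] with its largest coordinate. *)
have F_avg t : (1 - eta) ^+ 2 * enorm t <= Num.sqrt n%:R *
    \sum_i (w i)%:num * `|F t i|.
  rewrite big_sumType/= -!mulr_sumr.
  set A := \sum_s _; set B := \sum_j _.
  have B0 : 0 <= B by exact: sumr_ge0.
  have A_ge i : (1 - eta) * `|t 0 i| <= A / (2 ^ n)%:R.
    apply: le_trans (sign_average a t i); rewrite mulrC ler_wpM2l//.
  have : enorm t <= Num.sqrt n%:R * (A / (2 ^ n)%:R / (1 - eta)).
    apply: enorm_le_sqrt => [|i].
      by rewrite !divr_ge0 ?subr_ge0 ?(ltW eta1)//; apply: sumr_ge0.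
    by rewrite ler_pdivlMr ?subr_gt0// mulrC.
  move=> /(ler_wpM2l (sqr_ge0 (1 - eta))) /le_trans; apply.
  rewrite mulrCA ler_wpM2l ?sqrtr_ge0//.
  rewrite (_ : _ * (_ / _ / _) = (1 - eta) / (2 ^ n)%:R * A).
    by rewrite lerDl mulr_ge0// ltW.
  have p0 : (2 ^ n)%:R != 0 :> R by rewrite pnatr_eq0 -lt0n expn_gt0.
  have q0 : 1 - eta != 0 by rewrite subr_eq0 gt_eqF.
  move: q0 p0; move: (1 - eta) ((2 ^ n)%:R : R) => q p q0 p0.
  by field; rewrite p0 q0.
exists _, nat, (finprob w1); split; first exact: finprob_separable.
exists (span_of e); first by exists m; exists e.
exists (fun t => atomic_Linfty w1 (F t)); split.
- by move=> c t u; rewrite Flin atomic_LinftyP.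
- by move=> t; apply: atomic_Linfty_in => //; exact: span_of0.
- move=> t; rewrite -!lee_fin -Lp_normyE; apply/andP; split.
    have [i Fi] := F_ge t; apply: le_trans (atomic_Linfty_norm_ge w1 w0 _ i).
    by rewrite lee_fin.
  by apply: atomic_Linfty_norm_le => //; exact: enorm_ge0.
- by move=> t; rewrite atomic_L1_norm// -EFinM lee_fin.
Qed.

(** The coordinates are taken in an extremal basis of [X]. The lower bound of John's theorem makes
    [comb b] injective, so its chosen right inverse [c] is linear. *)
Lemma john_coordinates (X : normedModType R) n (eta : R) :
  has_dim [set: X] n -> 0 < eta <= 1 ->
  exists2 c : X -> 'rV[R]_n, linear c &
    forall x, `|x| <= enorm (c x) <= Num.sqrt n%:R * (1 + eta) * `|x|.
Proof.
move=> [e eI eX] eta01; have eta0 : 0 < eta by case/andP: eta01.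
have tau0 : 0 < eta ^+ 2 / 16 by rewrite divr_gt0// exprn_gt0.
have [A Aunit] := exists_extremal tau0 eI.
set b := (X in extremal _ X) => bE.
have bX x : exists t, comb b t = x.
  have : span_of e x by rewrite -eX.
  case=> s ->; exists (\row_i s i *m invmx A); rewrite comb_mul mulmxKV//.
  by apply: eq_bigr => i _; rewrite mxE.
have /choice[c cK] : forall x, exists t, comb b t = x by [].
have john t := extremal_lower_bound t eta01 bE.
have bI t : comb b t = 0 -> t = 0.
  move=> bt; apply: enorm_eq0; apply/eqP; rewrite eq_le enorm_ge0 andbT.
  by apply: le_trans (john t) _; rewrite bt normr0 mulr0.
exists c => [k x y|x].
  by apply/eqP; rewrite -subr_eq0; apply/eqP/bI; rewrite linearB linearP/= !cK subrr.
have := extremal_norm_le (c x) bE; have := john (c x).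
by rewrite cK => -> ->.
Qed.

End hilbert_embedding.

(** * Distortion of nets and of the whole space *)

Section discretization.
Context {R : realType}.

Lemma distortion_into_mono (X Y : normedModType R) (A B : set X) :
  A `<=` B -> (distortion_into Y A <= distortion_into Y B)%E.
Proof.
move=> AB; apply: ereal_inf_le_tmp => _ [K [phi [r r0 phiK]] <-].
exists K => //; exists phi; exists r => // u v Au Av; apply: phiK; exact: AB.
Qed.

Lemma has_dim_neq0 (X : lmodType R) n :
  has_dim [set: X] n -> (0 < n)%N -> exists x : X, x != 0.
Proof.
move=> [e eI _] n0; exists (e (Ordinal n0)); apply/eqP => e0.
have s0 : \sum_i (i == Ordinal n0)%:R *: e i = 0.
  rewrite big1// => i _; have [->|] := eqVneq i (Ordinal n0).
    by rewrite e0 scaler0.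
  by rewrite scale0r.
by have /eqP := eI _ s0 (Ordinal n0); rewrite eqxx oner_eq0.
Qed.

(** Antipodal unit vectors are at distance 2, so with [delta < 1] no point is within [delta] of
    both. The net thus has two distinct points, and these force [C >= 1]. *)
Lemma distortion_into_net_ge1 (X Y : normedModType R) (delta : R) (N : set X) :
  (exists x : X, x != 0) -> delta < 1 -> is_net delta N ->
  (1 <= distortion_into Y N)%E.
Proof.
move=> [x x0] delta1 [_ Nnet].
pose u := `|x|^-1 *: x.
have u1 : `|u| = 1 by rewrite normrZ ger0_norm ?invr_ge0// mulVf// normr_eq0.
have [y Ny uy] : exists2 y, N y & `|u - y| <= delta.
  by apply: Nnet; rewrite /unit_ball/= u1.
have [z Nz uz] : exists2 z, N z & `|- u - z| <= delta.
  by apply: Nnet; rewrite /unit_ball/= normrN u1.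
have yz : 0 < `|y - z|.
  rewrite normr_gt0 subr_eq0; apply/eqP => eyz.
  have : `|u + u| <= delta + delta.
    have -> : u + u = (u - y) - (- u - z) by rewrite eyz opprB opprK addrA subrK.
    by apply: le_trans (ler_normB _ _) _; exact: lerD.
  by rewrite -mulr2n normrMn u1 -mulr2n lerMn2r/= leNgt delta1.
apply: le_ereal_inf_tmp => _ [K [phi [r r0 phiK]] <-]; rewrite lee_fin.
have /andP[lo up] := phiK y z Ny Nz.
have := le_trans lo up.
by rewrite -mulrA ler_pM2l// -[leLHS]mul1r ler_pM2r.
Qed.

Lemma powR_5_2 (x : R) : 0 <= x -> x `^ (5 / 2) = x ^+ 2 * Num.sqrt x.
Proof.
rewrite le_eqVlt => /orP[/eqP <-|x0].
  by rewrite powR0 ?mulf_neq0 ?invr_eq0// expr0n mul0r.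
rewrite (_ : 5 / 2 = 2%:R + 2^-1); last by field.
by rewrite powRD ?gt_eqF ?implybT// powR_mulrn ?ltW// powR12_sqrt// ltW.
Qed.

Lemma distortion_le_of_sqrt_dim (X : normedModType R)
    (Y : completeNormedModType R) (f : R -> R) n (eps C : R) :
  ~ findim_subspace [set: Y] -> LB_discretization Y f ->
  (0 < n)%N -> has_dim [set: X] n -> 0 < eps < 1 ->
  (1 + eps) / (1 - eps) * Num.sqrt n%:R <= C ->
  (distortion_into Y [set: X] <= (C * f C)%:E)%E.
Proof.
move=> Yinf Yf n0 Xn /andP[eps0 eps1] leC.
(* With this [eta], the total loss [(1 + eta) / (1 - eta)^2] is at most [(1 + eps) / (1 - eps)]. *)
pose eta := eps / 4; pose A := (1 - eta) ^+ 2; pose q := Num.sqrt n%:R : R.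
have eta01 : 0 < eta < 1 by rewrite /eta; apply/andP; split; lra.
have eta01' : 0 < eta <= 1 by rewrite /eta; apply/andP; split; lra.
have A0 : 0 < A by rewrite exprn_gt0// /eta; lra.
have q1 : 1 <= q by rewrite -[leLHS]sqrtr1 ler_wsqrtr// ler1n.
have qA : q * (1 + eta) <= A * C.
  apply: le_trans (_ : A * ((1 + eps) / (1 - eps) * q) <= _); last first.
    by rewrite ler_wpM2l// ltW.
  rewrite mulrA mulrC ler_wpM2r//; first by lra.
  rewrite mulrA ler_pdivlMr ?subr_gt0// /A /eta; nra.
have [c clin cX] := john_coordinates Xn eta01'.
have [d [S [nu [nuS [Z Zfin [T [Tlin TZ TA T1]]]]]]] :=
  euclidean_in_Linfty Yinf n0 eta01.
have A1 : A <= 1 by rewrite /A /eta; nra.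
apply: (LB_discretization_embed (T := T \o c) (A := A) (B := q * (1 + eta))
    Yf nuS Zfin Xn (has_dim_neq0 Xn n0)) => //.
- by move=> a x y /=; rewrite clin Tlin.
- by move=> x; exact: TZ.
- by nra.
- move=> x /=; have /andP[Tlo Tup] := TA (c x); have /andP[clo cup] := cX x.
  rewrite (le_trans Tup cup) andbT (le_trans _ Tlo)// ler_wpM2l// ltW//.
- move=> x; rewrite /= Lp_normyE.
  have /andP[_ Tup] := TA (c x).
  have C0 : 0 <= C by nra.
  have qC : q <= A * C by rewrite /eta in qA; nra.
  have := T1 (c x); case: (Lp_norm 1 (T (c x))) => [y| |].
  + rewrite -!EFinM !lee_fin => Ay; apply: le_trans Tup _.
    have e0 := enorm_ge0 (c x).
    have y0 : 0 <= y.
      rewrite -(pmulr_rge0 _ (lt_le_trans ltr01 q1)); apply: le_trans Ay.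
      by rewrite mulr_ge0// ltW.
    have : A * enorm (c x) <= A * (C * y).
      apply: le_trans Ay _; rewrite mulrA ler_wpM2r//.
    by rewrite ler_pM2l.
  + by move=> _; rewrite gt0_muley ?leey// lte_fin; nra.
  + by rewrite gt0_muleNy// lte_fin (lt_le_trans ltr01).
Qed.

End discretization.

Theorem corollary1p5 (R : realType) (kappa : R)
    (kappa01 : 0 < kappa <= 1) (kappaP : GNS_constant kappa)
    (Y : completeNormedModType R) (Y_infdim : ~ findim_subspace [set: Y])
    (f : R -> R) (Yf : LB_discretization Y f)
    (X : completeNormedModType R) (n : nat) (n_ge1 : (1 <= n)%N)
    (X_dim : has_dim [set: X] n) (eps : R) (eps01 : 0 < eps < 1) :
  let g := fun t : R => t * f t in
  (forall (delta : R) (N : set X), 0 < delta < 1 ->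
     delta <= kappa * eps ^+ 2 / n%:R `^ (5 / 2) ->
     is_net delta N -> discretization_bound Y g eps N) /\
  ((forall s t : R, 1 <= s -> s <= t -> g s <= g t) ->
     kappa * eps ^+ 2 / n%:R `^ (5 / 2) <= discretization_modulus X Y g eps).
Proof.
move=> g; have /andP[eps0 eps1] := eps01; have /andP[kappa0 kappa1] := kappa01.
have bound (delta : R) (N : set X) : 0 < delta < 1 ->
    delta <= kappa * eps ^+ 2 / n%:R `^ (5 / 2) ->
    is_net delta N -> discretization_bound Y g eps N.
  move=> delta01 delta_le Nnet; have /andP[delta0 delta1] := delta01.
  have q1 : 1 <= Num.sqrt n%:R :> R by rewrite -[leLHS]sqrtr1 ler_wsqrtr// ler1n.
  have C0 : 1 <= (1 + eps) / (1 - eps) by rewrite ler_pdivlMr; lra.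
  have ge1 : (1 <= distortion_into Y N)%E.
    exact: distortion_into_net_ge1 (has_dim_neq0 X_dim n_ge1) delta1 Nnet.
  (* The net inherits a finite distortion from [X], which embeds into [Y] by the construction
     through Euclidean space. *)
  have Dfin : distortion_into Y N \is a fin_num.
    rewrite ge0_fin_numE; last exact: le_trans ge1.
    apply: le_lt_trans (distortion_into_mono _ (@subsetT _ N)) _.
    exact: le_lt_trans (distortion_le_of_sqrt_dim Y_infdim Yf n_ge1 X_dim eps01
      (lexx _)) (ltry _).
  split=> //; set D := fine _.
  have DE : distortion_into Y N = D%:E by rewrite fineK.
  have D1 : 1 <= D by rewrite -lee_fin -DE.
  (* If [D] is at least [sqrt n], that construction already gives the bound. Otherwise
     [n^2 D <= n^(5/2)], so [delta] is small enough for property (P). *)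
  have [qD|/ltW Dq] := leP (Num.sqrt n%:R) D.
    apply: (distortion_le_of_sqrt_dim Y_infdim Yf n_ge1 X_dim eps01).
    by rewrite ler_wpM2l//; lra.
  have delta_leD : delta <= kappa * eps ^+ 2 / (n%:R ^+ 2 * D).
    apply: le_trans delta_le _; rewrite ler_wpM2l//.
      by rewrite mulr_ge0 ?sqr_ge0// ltW.
    rewrite powR_5_2// lef_pV2 ?posrE ?mulr_gt0 ?exprn_gt0 ?ltr0n//.
      by rewrite ler_wpM2l// sqr_ge0.
    - by lra.
    - by lra.
  have [|d [S [nu [nuS [Z Zfin [T TZ TX]]]]]] :=
    kappaP delta eps D n X Y N delta01 eps01 D1 delta_leD X_dim Nnet; first by rewrite DE.
  have A0 : 0 < (1 - eps) / D by rewrite divr_gt0//; lra.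
  pose C := (1 + eps) / (1 - eps) * D.
  have AC : (1 - eps) / D * C = 1 + eps.
    by rewrite /C; field; apply/andP; split; rewrite gt_eqF//; lra.
  have C1 : 1 <= C by rewrite /C; nra.
  apply: (LB_discretization_embed (T := T) (A := (1 - eps) / D) (B := 1 + eps)
    Yf nuS Zfin X_dim (has_dim_neq0 X_dim n_ge1)) => //.
  - exact: linearP.
  - by rewrite AC.
  - move=> x; have [T1 T1y Ty] := TX x.
    by rewrite -!lee_fin -Lp_normyE Ty andbT (le_trans T1).
  - move=> x; have [T1 T1y Ty] := TX x.
    apply: (@le_trans _ _ (C%:E * ((1 - eps) / D * `|x|)%:E)%E).
      by rewrite -EFinM mulrA [C * _]mulrC AC.
    by rewrite lee_wpmul2l// lee_fin (le_trans ler01).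
split=> // _; set delta0 := kappa * _ / _.
have n1 : 1 <= n%:R `^ (5 / 2) :> R.
  apply: le_trans (_ : 1 `^ (5 / 2) <= _); first by rewrite powR1.
  by rewrite ge0_ler_powR ?nnegrE ?ler1n// divr_ge0.
have delta01 : 0 < delta0 < 1.
  rewrite divr_gt0 ?mulr_gt0 ?exprn_gt0//=; last exact: lt_le_trans n1.
  rewrite ltr_pdivrMr ?mul1r; last exact: lt_le_trans n1.
  by apply: lt_le_trans n1; nra.
(* The set defining the modulus is bounded by 1 and contains [delta0], so its supremum is at least
   [delta0]. *)
apply: ub_le_sup.
  by exists 1 => delta [/andP[_ /ltW]].
by split=> // N; exact: bound.
Qed.
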